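(* For any integers $d\ge 0$, $0\le m\le d$, $c_1,\ldots,c_d\in\mathbb{N}\setminus\{2\}$ such that $c_1\ge 3$ if $m\ge 1$, and any complex numbers $z_0,z_1,\ldots,z_d$ with $|z_j|<1$, $j=0,1,\ldots,d$, we have $$\sum_{\substack{a_0,a_1,\ldots,a_d\ge 0\\ a_m\ge 1}}\zeta^{\star}(\{2\}^{a_0},c_1,\{2\}^{a_1},\ldots,c_d,\{2\}^{a_d})\,z_0^{2a_0}z_1^{2a_1}\cdots z_d^{2a_d}=-z_m^2\sum_{k_0\ge k_1\ge\cdots\ge k_d\ge 1}\frac{1}{k_m^2}\,\prod_{i=0}^d\frac{(-1)^{k_i\delta_i}k_i^{\delta_i-1}}{k_i^2-z_i^2}\,S^{\sharp}_{k_{i-1},k_i}(\{1\}^{c_i-3}),$$ where $c_0=1$, $c_{d+1}=0$, $k_{-1}=0$, $\delta_i=\delta(c_i)+\delta(c_{i+1})$ for $0\le i\le d$, and $\delta(c)=2$ if $c=0$, $\delta(c)=1$ if $c=1$, $\delta(c)=0$ if $c\ge 3$.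
   Context: $\mathbb{N}$ is the set of positive integers. For positive integers $s_1,\ldots,s_m$ with $s_1\ge 2$, $\zeta^\star(s_1,\ldots,s_m)=\sum_{k_1\ge\cdots\ge k_m\ge 1}\frac{1}{k_1^{s_1}\cdots k_m^{s_m}}$ (sum over positive integers), and $\zeta^\star(\emptyset)=1$. $\{s\}^a$ denotes the sequence consisting of $a$ copies of $s$. When $d=0$ the argument string is just $\{2\}^{a_0}$. $\Delta(a,b)=0$ if $a=b$ and $\Delta(a,b)=1$ otherwise. For a string $\mathbf r=(r_1,\ldots,r_c)$ of positive integers and integers $k\ge 0$, $m\ge 1$, the multiple sharp sum is $$S^{\sharp}_{k,m}(r_1,\ldots,r_c)=\sum_{k\ge l_1\ge\cdots\ge l_c\ge m}\frac{2^{\Delta(k,l_1)+\Delta(l_1,l_2)+\cdots+\Delta(l_{c-1},l_c)+\Delta(l_c,m)}}{l_1^{r_1}\cdots l_c^{r_c}}\quad\text{if }\mathbf r\ne\emptyset\text{ and }k\ge m,$$ and $S^{\sharp}_{k,m}(\mathbf r)=2^{\Delta(k,m)}$ if $\mathbf r=\emptyset$ or $k<m$. The string $\{1\}^{c_i-3}$ is empty when $c_i\in\{1,3\}$, so that then $S^{\sharp}_{k_{i-1},k_i}(\{1\}^{c_i-3})=2^{\Delta(k_{i-1},k_i)}$. In all sums the indices are integers, and $0^0=1$ in power series. *)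

(* Defs.v *)
From HB Require Import structures.
From mathcomp Require Import all_boot all_order all_algebra.
From mathcomp Require Import finmap.
From mathcomp Require Import complex.
From mathcomp Require Import all_classical all_reals all_analysis.
From mathcomp.analysis.showcase Require summability.

Set Implicit Arguments.
Unset Strict Implicit.
Unset Printing Implicit Defensive.

Import Order.TTheory GRing.Theory Num.Theory.
Import numFieldNormedType.Exports.

Local Open Scope classical_set_scope.
Local Open Scope ring_scope.
Local Open Scope complex_scope.

(* Multi-index series of complex numbers are summed unconditionally, i.e. as
   limits of the net of their finite partial sums; in R[i] this is the same as
   absolute convergence.  The topology of R[i] lives on R[i]^o. *)
Definition csummable (R : realType) (T : choiceType) (D : set T)
    (f : T -> R[i]) : Prop :=
  cvg (summability.partial_sum (patch (fun=> 0) D f : T -> R[i]^o)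
         @ summability.totally).

(* Junk value unless [csummable D f] holds. *)
Definition csum (R : realType) (T : choiceType) (D : set T)
    (f : T -> R[i]) : R[i] :=
  summability.sum (patch (fun=> 0) D f : T -> R[i]^o).

(* The chain k_1 >= ... >= k_n >= 1. *)
Definition weakly_decreasing (n : nat) : set (n.-tuple nat) :=
  [set k : n.-tuple nat | sorted geq (rcons k 1%N)].
Arguments weakly_decreasing : clear implicits.

(* The terms are nonnegative, so the series is an [esum]; it is finite when
   the first argument is at least 2 (and 1 when s is empty). *)
Definition zeta_star (R : realType) (s : seq nat) : R :=
  fine (\esum_(k in weakly_decreasing (size s))
          (\prod_(i < size s) ((tnth k i)%:R ^+ nth 0%N s i)^-1)%:E).

Definition Delta (a b : nat) : nat := if a == b then 0 else 1.

(* Delta(k,l_1) + Delta(l_1,l_2) + ... + Delta(l_c,m) *)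
Definition jumps (k : nat) (l : seq nat) (m : nat) : nat :=
  (\sum_(p <- zip (k :: l) (rcons l m)) Delta p.1 p.2)%N.

(* [path geq k (rcons l m)] says k >= l_1 >= ... >= l_c >= m. *)
Definition sharp_sum (R : realType) (k m : nat) (r : seq nat) : R :=
  if nilp r || (k < m)%N then 2 ^+ Delta k m
  else \sum_(l : (size r).-tuple 'I_k.+1 |
               path geq k (rcons (map val l) m))
         2 ^+ jumps k (map val l) m
         / \prod_(i < size r) (tnth l i : nat)%:R ^+ nth 0%N r i.

(* Only used for c <> 2. *)
Definition delta (c : nat) : nat :=
  if c == 0%N then 2 else if c == 1%N then 1 else 0.

(* c_0, ..., c_{d+1}, with c_0 = 1 and c_{d+1} = 0 *)
Definition cext (d : nat) (c : d.-tuple nat) (i : nat) : nat :=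
  nth 0%N (1%N :: rcons c 0%N) i.

Definition delta_i (d : nat) (c : d.-tuple nat) (i : nat) : nat :=
  (delta (cext c i) + delta (cext c i.+1))%N.

(* {2}^{a_0}, c_1, {2}^{a_1}, ..., c_d, {2}^{a_d} *)
Definition two_string (d : nat) (c : d.-tuple nat) (a : d.+1.-tuple nat) :
    seq nat :=
  nseq (thead a) 2%N
  ++ flatten [seq p.1 :: nseq p.2 2%N | p <- zip c (behead a)].

Definition zeta_term (R : realType) (d : nat) (c : d.-tuple nat)
    (z : 'I_d.+1 -> R[i]) (a : d.+1.-tuple nat) : R[i] :=
  (zeta_star R (two_string c a))%:C
  * \prod_(j < d.+1) z j ^+ (2 * tnth a j).

(* [nth 0 (0 :: k) i] is k_{i-1}, with k_{-1} = 0; the exponent delta_i - 1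
   is an integer, equal to -1 when delta_i = 0; [cext c i - 3] is truncated,
   so that the string of ones is empty when c_i is 1 or 3. *)
Definition sharp_term (R : realType) (d : nat) (c : d.-tuple nat)
    (m : 'I_d.+1) (z : 'I_d.+1 -> R[i]) (k : d.+1.-tuple nat) : R[i] :=
  ((tnth k m)%:R ^+ 2)^-1
  * \prod_(i < d.+1)
      ((-1) ^+ (tnth k i * delta_i c i)
       * ((tnth k i)%:R : R[i]) ^ ((delta_i c i)%:Z - 1)
       / ((tnth k i)%:R ^+ 2 - z i ^+ 2)
       * (sharp_sum R (nth 0%N (0%N :: k) i) (tnth k i)
            (nseq (cext c i - 3) 1%N))%:C).

(* Main.v *)
Require Import Defs.
From HB Require Import structures.
From mathcomp Require Import all_boot all_order all_algebra.
From mathcomp Require Import finmap.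
From mathcomp Require Import complex.
From mathcomp Require Import ring lra zify.
From mathcomp Require Import all_classical all_reals all_analysis.
From mathcomp.analysis.showcase Require summability.

Import Order.TTheory GRing.Theory Num.Theory.
Import numFieldNormedType.Exports.

Local Open Scope classical_set_scope.
Local Open Scope ring_scope.
Local Open Scope complex_scope.

Set Implicit Arguments.
Unset Strict Implicit.
Unset Printing Implicit Defensive.

Local Notation Re := complex.Re.
Local Notation Im := complex.Im.

(** Everything follows from a finite identity.  Put
    [beta n k] = n!^2 / ((n-k)! (n+k)!) and let [sstar n s] be the star sum
    with all indices at most [n].  For n >= 1 and c_i <> 2,

      sstar n ({2}^a_0, c_1, {2}^a_1, ..., c_d, {2}^a_d)
        = - sum_(n >= k_0 >= ... >= k_d >= 1) beta n k_0
            prod_i (-1)^(k_i delta_i) k_i^(delta_i - 3 - 2 a_i)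
                   S#_(k_(i-1), k_i)({1}^(c_i - 3)).

    Both sides obey the same recursion in [n], by induction on the string: a
    leading 2 is removed through
    beta n k - beta (n-1) k = beta n k * k^2 / n^2, and a leading c_i through
    two telescoping sums of [beta n k] in [k], one for c_i = 1 and one for
    c_i >= 3; in the latter case the ones of the sharp sum are peeled off one
    at a time ([sstar_dual], [sum_beta_link]).

    Multiplying by the monomial in the z_j and summing over all [a] with
    a_m >= 1 produces, for each fixed chain k, a product of geometric series
    of ratios (z_i / k_i)^2; these turn k_i^(-2) into 1 / (k_i^2 - z_i^2) and
    the condition a_m >= 1 into the factor z_m^2 / k_m^2 ([hassum_sstar]).
    This is the theorem with [beta n k_0] inserted on the right and the star
    sums cut at [n] on the left.

    It remains to let [n] grow.  Both families of weights increase with [n],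
    to 1 and to the zeta star values, so dominated convergence applies
    ([hassum_monotone_weights]) as soon as partial sums are bounded.  On the
    right, the exponents are such that a term is at most a constant times
    k_0^(-2) k_1^(-1) ... k_d^(-1) times the sharp sums ([exponent_bound]), and
    the nested harmonic sums that result are dominated by the slowly growing
    function [growth] ([sum_majorant]).  The bound on the left, and with it the
    finiteness of the zeta star values, is then the level [n] identity at
    |z_j|. *)

(** * Central binomial weights and sharp sums *)

Lemma telescope_Ioc (V : zmodType) (u : nat -> V) (j n : nat) : (j <= n)%N ->
  \sum_(j.+1 <= k < n.+1) (u k.-1 - u k) = u j - u n.
Proof.
move=> jn; rewrite big_add1 -[RHS]opprB -telescope_sumr //= -sumrN.
by apply: eq_bigr => i _; rewrite opprB.
Qed.

Lemma exchange_triangle (V : nmodType) (a n : nat) (f : nat -> nat -> V) :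
  \sum_(a <= k < n) \sum_(a <= j < k.+1) f k j
  = \sum_(a <= j < n) \sum_(j <= k < n) f k j.
Proof.
elim: n => [|n IH]; first by rewrite !big_geq.
have [an|an] := leqP a n; last by rewrite !(big_geq an).
rewrite big_nat_recr //= IH [RHS]big_nat_recr //= big_nat1.
rewrite [X in _ + X]big_nat_recr //= addrA; congr (_ + _).
rewrite -big_split /= [LHS]big_nat_cond [RHS]big_nat_cond.
apply: eq_bigr => j /andP[/andP[_ jn] _].
by rewrite [RHS]big_nat_recr // ltnW.
Qed.

Section Beta.
Context {K : numFieldType}.

(** The number n!^2 / ((n-k)! (n+k)!); the factor n - k at k = n makes it
    vanish for all larger k, so that sums over k need no upper bound. *)
Fixpoint beta (n k : nat) : K :=
  if k is k'.+1 then beta n k' * ((n%:R - k'%:R) / (n + k'.+1)%:R) else 1.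

Lemma betaS n k :
  (n + k.+1)%:R * beta n k.+1 = (n%:R - k%:R) * beta n k.
Proof.
have N0 : (n + k.+1)%:R != 0 :> K by rewrite pnatr_eq0 addnS.
by rewrite /= mulrCA [_ * (_ / _)]mulrC divfK // mulrC.
Qed.

Lemma beta_gt n k : (n < k)%N -> beta n k = 0.
Proof.
elim: k => // k IH; rewrite ltnS leq_eqVlt => /orP[/eqP <-|/IH bk] /=.
  by rewrite subrr mul0r mulr0.
by rewrite bk mul0r.
Qed.

Lemma beta_ge0 n k : 0 <= beta n k.
Proof.
elim: k => [|k IH] //=; have [nk|kn] := ltnP n k; first by rewrite beta_gt ?mul0r.
by rewrite mulr_ge0 // divr_ge0 ?ler0n // subr_ge0 ler_nat.
Qed.

Lemma beta_le1 n k : beta n k <= 1.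
Proof.
elim: k => [|k IH] //=; have [nk|kn] := ltnP n k.
  by rewrite beta_gt ?mul0r.
rewrite mulr_ile1 ?beta_ge0 // ?divr_ge0 ?ler0n // ?subr_ge0 ?ler_nat //.
rewrite ler_pdivrMr ?ltr0n ?addnS // mul1r lerBlDr -natrD ler_nat; lia.
Qed.

(** From beta (n+1) k / beta n k = (n+1)^2 / ((n+1)^2 - k^2), which is where
    the factors k^2 of the dual sums come from. *)
Lemma beta_recl n k :
  n.+1%:R ^+ 2 * beta n k = (n.+1%:R ^+ 2 - k%:R ^+ 2) * beta n.+1 k.
Proof.
elim: k => [|k IH]; first by rewrite expr0n subr0.
have n0 : n.+1%:R + k.+1%:R != 0 :> K by rewrite -natrD pnatr_eq0 addnS.
have n1 : n%:R + k.+1%:R != 0 :> K by rewrite -natrD pnatr_eq0 addnS.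
rewrite /= !natrD mulrA IH -!(natr1 n) -!(natr1 k) in n0 n1 *.
by field; rewrite n0 n1.
Qed.

Arguments beta : simpl never.

Lemma beta_increment n k :
  beta n.+1 k = beta n k + n.+1%:R ^- 2 * k%:R ^+ 2 * beta n.+1 k.
Proof.
have n0 : n.+1%:R != 0 :> K by rewrite pnatr_eq0.
apply: (mulfI (expf_neq0 2 n0)); rewrite mulrDr beta_recl; field.
by rewrite addrC natr1 n0.
Qed.

(** Telescopes, since (n + k) beta n k = (n - k + 1) beta n (k-1) gives
    2 k beta n k as a difference of consecutive values of (n - k) beta n k.
    This handles an entry 1 of the string. *)
Lemma sum_nat_beta j n : (j <= n)%N ->
  \sum_(j <= k < n.+1) k%:R * beta n k * 2 ^+ Delta k j = n%:R * beta n j.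
Proof.
move=> jn; rewrite big_ltn ?ltnS // /Delta eqxx expr0 mulr1.
rewrite (eq_big_nat _ _ (F2 := fun k =>
  (n%:R - k.-1%:R) * beta n k.-1 - (n%:R - k%:R) * beta n k)); last first.
  case=> // k /andP[jk _]; rewrite gtn_eqF //= expr1 -betaS natrD.
  by ring.
rewrite (telescope_Ioc (fun k => (n%:R - k%:R) * beta n k)) //.
by rewrite subrr mul0r subr0 -mulrDl addrC subrK.
Qed.

(** The alternating companion: the same relation with opposite signs gives
    2 n beta n k instead of 2 k beta n k. *)
Lemma sum_sign_beta j n : (j <= n)%N ->
  n%:R * \sum_(j <= k < n.+1) (-1) ^+ k * beta n k * 2 ^+ Delta k j
  = (-1) ^+ j * j%:R * beta n j.
Proof.
move=> jn; rewrite big_ltn ?ltnS // /Delta eqxx expr0 mulr1 mulrDr mulr_sumr.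
rewrite (eq_big_nat _ _ (F2 := fun k =>
  - ((-1) ^+ k.-1 * ((n%:R - k.-1%:R) * beta n k.-1))
  - - ((-1) ^+ k * ((n%:R - k%:R) * beta n k)))); last first.
  case=> // k /andP[jk _]; rewrite gtn_eqF //= expr1 -betaS natrD exprS.
  by ring.
rewrite (telescope_Ioc (fun k => - ((-1) ^+ k * ((n%:R - k%:R) * beta n k)))) //.
by ring.
Qed.

(** The sharp sum peeled at its largest index, over any field of
    characteristic 0; it agrees with [sharp_sum] when m <= k. *)
Fixpoint sharp (k m : nat) (r : seq nat) : K :=
  if r is s :: r' then
    \sum_(m <= l < k.+1) 2 ^+ Delta k l / l%:R ^+ s * sharp l m r'
  else 2 ^+ Delta k m.

Lemma sharp_ge0 k m r : 0 <= sharp k m r.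
Proof.
elim: r k => [|s r IH] k /=; first exact: exprn_ge0.
by apply: sumr_ge0 => l _; rewrite mulr_ge0 // divr_ge0 // exprn_ge0.
Qed.

(** This handles an entry c + 3 >= 3 of the string.  Each 1 in the sharp sum
    costs a factor n: exchanging the two outer summations reduces the sum over
    the largest index to [sum_sign_beta], whose factor l cancels 1 / l. *)
Lemma sum_sign_beta_sharp c j n : (0 < j <= n)%N ->
  n%:R ^+ c.+1 * \sum_(j <= k < n.+1) (-1) ^+ k * beta n k * sharp k j (nseq c 1%N)
  = (-1) ^+ j * j%:R * beta n j.
Proof.
move=> /andP[j0 jn]; elim: c => [|c IH]; first by rewrite expr1 sum_sign_beta.
rewrite -{}IH exprSr -mulrA; congr (_ * _).
under eq_bigr => k _ do rewrite /= mulr_sumr.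
rewrite exchange_triangle mulr_sumr [LHS]big_nat_cond [RHS]big_nat_cond.
apply: eq_bigr => l /andP[/andP[jl ln] _].
have l0 : l%:R != 0 :> K by rewrite pnatr_eq0; lia.
apply: (mulfI l0).
rewrite [RHS](_ : _ = (-1) ^+ l * l%:R * beta n l * sharp l j (nseq c 1%N)); last by ring.
rewrite -(sum_sign_beta (j := l)) // -mulrA mulrCA; congr (_ * _); rewrite mulr_suml mulr_sumr.
by apply: eq_bigr => k _; rewrite expr1; field.
Qed.

End Beta.

Arguments beta {K} n k : simpl never.

(** * The finite duality *)

Section FiniteIdentity.
Context {K : numFieldType}.

(** The contribution of one index k of the dual sum, with previous index p,
    between the entries c and c' of the string; the factors k^(-2-2a) or
    1 / (k^2 - z^2) are kept apart. *)
Definition link (c c' p k : nat) : K :=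
  (-1) ^+ (k * (delta c + delta c'))
  * k%:R ^ ((delta c + delta c')%:Z - 1) * sharp p k (nseq (c - 3) 1%N).

Lemma linkE c c' p k : (0 < k)%N ->
  link c c' p k = (-1) ^+ (k * (delta c + delta c'))
    * (k%:R ^+ (delta c + delta c') / k%:R) * sharp p k (nseq (c - 3) 1%N).
Proof.
by move=> k0; rewrite /link expfzDr ?exprN1 // pnatr_eq0 -lt0n.
Qed.

Lemma link1 c' k : (0 < k)%N ->
  link 1 c' 0 k = 2 * ((-1) ^+ (k * (1 + delta c')) * k%:R ^+ delta c').
Proof.
move=> k0; rewrite linkE //= /Delta eq_sym gtn_eqF //= expr1 exprS mulrC.
by congr (_ * (_ * _)); field; rewrite pnatr_eq0 -lt0n.
Qed.

(** The step that moves an entry c across: summing out the index k in front of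
    j replaces [link c c' k j] by the initial factor [link 1 c' 0 j]. *)
Lemma sum_beta_link c c' j n : (0 < c)%N -> c <> 2 -> (0 < j <= n)%N ->
  \sum_(j <= k < n.+1) beta n k * link 1 c 0 k * link c c' k j
  = n%:R ^+ 2 / n%:R ^+ c * (beta n j * link 1 c' 0 j).
Proof.
move=> c0 c2 /andP[j0 jn].
have [j0' n0'] : j%:R != 0 :> K /\ n%:R != 0 :> K.
  by rewrite !pnatr_eq0 -!lt0n (leq_trans j0 jn).
have [c1|c1] := eqVneq c 1%N.
  rewrite c1 expr1 expr2 mulfK // mulrA -sum_nat_beta // mulr_suml.
  apply: eq_big_nat => k /andP[jk _].
  have k0 : (0 < k)%N by lia.
  rewrite !link1 // linkE //= exprS expr0 -[delta 1]/(1%N) [_%:R ^+ (1 + delta c')]exprD.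
  rewrite muln2 -mul2n exprM expr2 mulN1r opprK expr1n mul1r.
  by field.
have {c0 c2 c1} c3 : (3 <= c)%N by move/eqP: c1; lia.
have dc : delta c = 0%N by rewrite /delta !gtn_eqF //; lia.
have -> : n%:R ^+ c = n%:R ^+ (c - 3).+1 * n%:R ^+ 2 :> K.
  by rewrite -exprD; congr (_ ^+ _); lia.
transitivity ((2 : K) * ((-1) ^+ (j * delta c') * (j%:R ^+ delta c' / j%:R)) *
    \sum_(j <= k < n.+1) (-1) ^+ k * beta n k * sharp k j (nseq (c - 3) 1%N)).
  rewrite mulr_sumr; apply: eq_big_nat => k /andP[jk _].
  rewrite link1 ?linkE //; last by lia.
  by rewrite dc addn0 muln1 expr0; ring.
apply: (mulfI (expf_neq0 (c - 3).+1 n0')).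
rewrite mulrCA sum_sign_beta_sharp ?j0 // link1 // mulnDr muln1 !exprD.
move: (expf_neq0 (c - 3).+1 n0'); move: (n%:R ^+ (c - 3).+1) => N N0.
move: (_ ^+ delta c') ((-1) ^+ j) ((-1) ^+ (j * _)) => u v w.
by field; rewrite j0' n0' N0.
Qed.

Definition twos_string (a : nat) (l : seq (nat * nat)) : seq nat :=
  nseq a 2%N ++ flatten [seq p.1 :: nseq p.2 2%N | p <- l].

Fixpoint sstar (n : nat) (s : seq nat) : K :=
  if s is a :: s' then \sum_(1 <= k < n.+1) (k%:R ^+ a)^-1 * sstar k s' else 1.

Definition next (l : seq (nat * nat)) : nat := head 0%N (unzip1 l).

(** The dual sum over the indices after the first one, all at most n, with p
    the index before them. *)
Fixpoint tail_sum (p n : nat) (l : seq (nat * nat)) : K :=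
  if l is (c, a) :: l' then
    \sum_(1 <= k < n.+1)
      link c (next l') p k * (k%:R ^+ a.*2.+2)^-1 * tail_sum k k l'
  else 1.

Definition dual_sum (n a : nat) (l : seq (nat * nat)) : K :=
  \sum_(1 <= k < n.+1)
    beta n k * (link 1 (next l) 0 k * (k%:R ^+ a.*2.+2)^-1 * tail_sum k k l).

Lemma dual_sum0 a l : dual_sum 0 a l = 0.
Proof. by rewrite /dual_sum big_geq. Qed.

Lemma dual_sum_recl n a l :
  dual_sum n.+1 a l = dual_sum n a l + (n.+1%:R ^+ 2)^-1 *
    \sum_(1 <= k < n.+2) beta n.+1 k * link 1 (next l) 0 k * (k%:R ^+ a.*2)^-1
      * tail_sum k k l.
Proof.
rewrite /dual_sum.
have -> : \sum_(1 <= k < n.+1) beta n k *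
    (link 1 (next l) 0 k * (k%:R ^+ a.*2.+2)^-1 * tail_sum k k l) =
  \sum_(1 <= k < n.+2) beta n k *
    (link 1 (next l) 0 k * (k%:R ^+ a.*2.+2)^-1 * tail_sum k k l).
  by rewrite [RHS]big_nat_recr //= beta_gt // mul0r addr0.
rewrite mulr_sumr -big_split /=; apply: eq_big_nat => k /andP[k0 _].
rewrite [in LHS]beta_increment mulrDl; congr (_ + _).
by rewrite -(addn2 a.*2) exprD; field; rewrite addrC natr1 expf_neq0 !pnatr_eq0 -!lt0n ?k0.
Qed.

Lemma dual_sumS n a l :
  dual_sum n.+1 a.+1 l = dual_sum n a.+1 l
    + (n.+1%:R ^+ 2)^-1 * dual_sum n.+1 a l.
Proof.
rewrite dual_sum_recl; congr (_ + _ * _).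
by apply: eq_big_nat => k _; rewrite !mulrA.
Qed.

Lemma dual_sum_cons n c a l : (0 < c)%N -> c <> 2 ->
  dual_sum n.+1 0 ((c, a) :: l) = dual_sum n 0 ((c, a) :: l)
    + (n.+1%:R ^+ c)^-1 * dual_sum n.+1 a l.
Proof.
move=> c0 c2; rewrite dual_sum_recl; congr (_ + _).
under eq_big_nat => k _ do rewrite expr0 invr1 mulr1 /= mulr_sumr.
rewrite exchange_triangle /dual_sum !mulr_sumr; apply: eq_big_nat => j jn.
have n0 : n.+1%:R != 0 :> K by rewrite pnatr_eq0.
transitivity ((n.+1%:R ^+ 2)^-1 * ((j%:R ^+ a.*2.+2)^-1 * tail_sum j j l) *
   \sum_(j <= k < n.+2) beta n.+1 k * link 1 c 0 k * link c (next l) k j).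
  rewrite -[RHS]mulrA; congr (_ * _); rewrite mulr_sumr; apply: eq_bigr => k _.
  by rewrite /next /=; ring.
rewrite sum_beta_link //; field.
by rewrite addrC natr1 !expf_neq0 ?n0 // pnatr_eq0; lia.
Qed.

(** The case j = 0 of [sum_sign_beta]: its right-hand side vanishes. *)
Lemma dual_sum_nil n : dual_sum n.+1 0 [::] = -1.
Proof.
have n0 : n.+1%:R != 0 :> K by rewrite pnatr_eq0.
have := sum_sign_beta (K := K) (leq0n n.+1).
rewrite mulr0 mul0r => /eqP; rewrite mulf_eq0 (negPf n0) /= big_ltn //.
rewrite expr0 mul1r {1}/Delta eqxx expr0 mulr1 addrC addr_eq0 => /eqP <-.
apply: eq_big_nat => k /andP[k0 _]; rewrite link1 // /Delta gtn_eqF //= mulr1.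
rewrite -signr_odd oddM andbT signr_odd -[delta 0]/(2%N) /=.
by field; rewrite pnatr_eq0; lia.
Qed.

(** Both sides satisfy the same recursion in n, from [dual_sumS] when the
    string starts with 2 and from [dual_sum_cons] when it starts with an entry
    c.  At n = 0 both sides vanish for a nonempty string, but not for the empty
    one, hence the hypothesis 0 < n. *)
Lemma sstar_dual n a l : (0 < n)%N ->
  all (fun p => (0 < p.1)%N && (p.1 != 2%N)) l ->
  sstar n (twos_string a l) = - dual_sum n a l.
Proof.
move=> n0 hl; elim: l hl a n n0 => [|[c b] l IHl] /= hl a.
  elim: a => [|a IHa].
    by case=> // n _; rewrite dual_sum_nil opprK.
  case=> // n _; elim: n => [|n IHn].
    by rewrite dual_sumS dual_sum0 add0r /= big_nat1 IHa // mulrN.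
  by rewrite dual_sumS opprD -IHn /= big_nat_recr //= IHa // mulrN.
case/andP: hl => /andP[/= c0 /eqP c2] {}/IHl IHl.
elim: a => [|a IHa]; case=> // n _; elim: n => [|n IHn].
- by rewrite dual_sum_cons // dual_sum0 add0r /= big_nat1 IHl // mulrN.
- by rewrite dual_sum_cons // opprD -IHn /= big_nat_recr //= IHl // mulrN.
- by rewrite dual_sumS dual_sum0 add0r /= big_nat1 IHa // mulrN.
- by rewrite dual_sumS opprD -IHn /= big_nat_recr //= IHa // mulrN.
Qed.

End FiniteIdentity.

(** * Sums over decreasing chains *)

Section Decreasing.
Context {K : numFieldType}.

Fixpoint chains (d n : nat) : seq (d.-tuple nat) :=
  if d is d'.+1 then
    [seq [tuple of k :: t] | k : nat <- index_iota 1 n.+1, t : d'.-tuple nat <- chains d' k]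
  else [:: [tuple]].

Lemma mem_chains d n (t : d.-tuple nat) :
  (t \in chains d n) = path geq n t && all (leq 1) t.
Proof.
elim: d n t => [|d IH] n t; first by rewrite tuple0 mem_seq1 eqxx.
case/tupleP: t => x t /=; apply/allpairsPdep/idP.
  move=> [k [u [kn ut e]]]; have [-> ->] : x = k /\ t = u.
    by move/(congr1 val): e => /= -[-> /val_inj ->].
  by move: kn ut; rewrite mem_index_iota IH ltnS => /andP[-> ->] /andP[-> ->].
move=> /andP[/andP[xn xt] /andP[x0 t0]]; exists x, t; split => //.
  by rewrite mem_index_iota x0 ltnS.
by rewrite IH xt t0.
Qed.

Lemma chains_uniq d n : uniq (chains d n).
Proof.
elim: d n => [|d IH] n //=; apply: allpairs_uniq_dep => //.
  exact: iota_uniq.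
by move=> [x t] [y u] _ _ /= /(congr1 val) /= -[-> /val_inj ->].
Qed.

Lemma path_rcons1 x (t : seq nat) :
  path geq x (rcons t 1%N) = path geq x t && all (leq 1) (x :: t).
Proof.
elim: t x => [|y t IH] x /=; first by rewrite !andbT.
rewrite IH /=; case: (leqP y x) => //= yx.
by case: (leqP 1 y) => //= y0; rewrite ?andbF // (leq_trans y0 yx).
Qed.

Lemma mem_chainsS d (t : d.+1.-tuple nat) n :
  (t \in chains d.+1 n) = (sorted geq (rcons t 1%N)) && (thead t <= n)%N.
Proof.
case/tupleP: t => x t; rewrite mem_chains theadE /= path_rcons1 /=.
by rewrite [RHS]andbC !andbA.
Qed.

(** Iterated form of a sum over chains of a product whose factors depend only on
    the position, the previous index and the current one; p stands in front
    of the first index. *)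
Fixpoint nest (f : nat -> nat -> nat -> K) (d p n : nat) : K :=
  if d is d'.+1 then
    \sum_(1 <= k < n.+1) f 0%N p k * nest (fun i => f i.+1) d' k k
  else 1.

Lemma sum_chains d n (F : d.+1.-tuple nat -> K) :
  \sum_(t <- chains d.+1 n) F t
  = \sum_(1 <= k < n.+1) \sum_(t <- chains d k) F [tuple of k :: t].
Proof. by rewrite big_allpairs_dep. Qed.

Lemma sum_chains_prod (f : nat -> nat -> nat -> K) d p n :
  \sum_(t <- chains d n) \prod_(i < d) f i (nth 0%N (p :: t) i) (tnth t i)
  = nest f d p n.
Proof.
elim: d f p n => [|d IH] f p n; first by rewrite big_seq1 big_ord0.
rewrite sum_chains /=; apply: eq_bigr => k _; rewrite -IH mulr_sumr.
apply: eq_bigr => t _; rewrite big_ord_recl; congr (_ * _).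
by apply: eq_bigr => i _; rewrite tnthS.
Qed.

Lemma eq_nest (f g : nat -> nat -> nat -> K) d p n :
  (forall i q k, (i < d)%N -> (0 < k)%N -> f i q k = g i q k) ->
  nest f d p n = nest g d p n.
Proof.
elim: d f g p n => [//|d IH] f g p n fg /=; apply: eq_big_nat => k /andP[k0 _].
by rewrite fg //; congr (_ * _); apply: IH => i q j id j0; apply: fg.
Qed.

Lemma sstar_nest n s :
  sstar n s = nest (fun i _ k => (k%:R ^+ nth 0%N s i)^-1) (size s) 0 n :> K.
Proof.
suff H p : sstar n s = nest (fun i _ k => (k%:R ^+ nth 0%N s i)^-1) (size s) p n.
  exact: H.
by elim: s n p => [//|a s IH] n p /=; apply: eq_bigr => k _; rewrite (IH k k).
Qed.

Lemma tail_sum_nest p n l :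
  tail_sum p n l = nest (fun i q k => link (nth 0%N (unzip1 l) i)
    (nth 0%N (unzip1 l) i.+1) q k
    * (k%:R ^+ (nth 0%N (unzip2 l) i).*2.+2)^-1) (size l) p n.
Proof.
elim: l p n => [//|[c a] l IH] p n /=; apply: eq_bigr => k _.
by rewrite IH /next -nth0.
Qed.

Lemma dual_sum_nest n a l d : size l = d ->
  dual_sum n a l = (\sum_(t <- chains d.+1 n) beta n (thead t) *
    \prod_(i < d.+1)
      (link (nth 0%N (1%N :: unzip1 l) i) (nth 0%N (1%N :: unzip1 l) i.+1)
         (nth 0%N (0%N :: t) i) (tnth t i)
       * ((tnth t i)%:R ^+ (nth 0%N (a :: unzip2 l) i).*2.+2)^-1)) :> K.
Proof.
move=> <-; rewrite sum_chains /dual_sum; apply: eq_big_nat => k _.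
rewrite tail_sum_nest -sum_chains_prod !mulr_sumr; apply: eq_bigr => t _.
rewrite big_ord_recl theadE /next -nth0; congr (_ * (_ * _)).
by apply: eq_bigr => i _; rewrite tnthS.
Qed.

End Decreasing.

(** * Growth of nested harmonic sums *)

Section Growth.
Context {K : numFieldType}.

(** The product of (1 - 1 / (2 l))^(-1) for l <= n, of order sqrt n.  It
    replaces powers of logarithms: it is reproduced, up to a constant, by
    summation against 1 / l, and still summable against 1 / k^2. *)
Fixpoint growth (n : nat) : K :=
  if n is n'.+1 then growth n' * (n.*2%:R / n'.*2.+1%:R) else 1.

Lemma growth_ge1 n : 1 <= growth n.
Proof.
elim: n => [|n IH] //=; rewrite mulr_ege1 // ler_pdivlMr ?ltr0n // mul1r.
by rewrite ler_nat doubleS.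
Qed.

Lemma growth_ge0 n : 0 <= growth n.
Proof. exact: le_trans ler01 (growth_ge1 n). Qed.

Lemma growthS n : growth n.+1 / n.+1%:R = 2 * (growth n.+1 - growth n).
Proof.
have Dd m : m.*2%:R = 2 * m%:R :> K by rewrite -mul2n natrM.
have N1 : 2 * n%:R + 1 != 0 :> K by rewrite -Dd natr1 pnatr_eq0.
have N2 : n%:R + 1 != 0 :> K by rewrite natr1 pnatr_eq0.
by rewrite /= Dd -[n.*2.+1%:R]natr1 Dd -!natr1; field; rewrite N1 N2.
Qed.

Arguments growth : simpl never.

Lemma sum_growth n : \sum_(1 <= k < n.+1) growth k / k%:R = 2 * (growth n - 1).
Proof.
elim: n => [|n IH]; first by rewrite big_geq // subrr mulr0.
by rewrite big_nat_recr //= IH growthS; ring.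
Qed.

(** The bound 6 - 2 growth n / n is proved by induction: growth k / k decreases
    fast enough to pay for each new term. *)
Lemma sum_growth2 n : \sum_(1 <= k < n.+1) growth k / k%:R ^+ 2 <= 6.
Proof.
suff H m : \sum_(1 <= k < m.+2) growth k / k%:R ^+ 2
    <= 6 - 2 * (growth m.+1 / m.+1%:R).
  case: n => [|n]; first by rewrite big_geq.
  by apply: le_trans (H n) _; rewrite gerBl mulr_ge0 // divr_ge0 // growth_ge0.
elim: m => [|m IH].
  rewrite big_nat1 -[growth 1]/(1 * (2%:R / 1%:R)) expr1n !divr1 mul1r.
  by rewrite lerBrDr -natrM -natrD ler_nat.
rewrite big_nat_recr //=; apply: le_trans (lerD IH (lexx _)) _.
rewrite -addrA lerD2l.
have m1 : m.+1%:R != 0 :> K by rewrite pnatr_eq0.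
have m2 : m.+2%:R != 0 :> K by rewrite pnatr_eq0.
have /eqP := growthS m.+1; set g := growth m.+2; set h := growth m.+1 => /eqP E.
have -> : h = g - g / m.+2%:R / 2 by rewrite E; field.
rewrite -subr_ge0 (_ : _ - _ = g / (m.+1%:R * m.+2%:R ^+ 2)).
  by rewrite divr_ge0 ?growth_ge0 // mulr_ge0 ?exprn_ge0.
by rewrite -!natr1 in m1 m2 *; field; rewrite m1 m2.
Qed.

(** Each 1 in the sharp sum is one more summation against 1 / k, with a power
    of two at most 2, hence costs a factor 4 by [sum_growth]. *)
Lemma sharp_growth j r :
  \sum_(1 <= l < j.+1) (l%:R)^-1 * sharp j l (nseq r 1%N) * growth l
  <= 4 ^+ r.+1 * growth j.
Proof.
have pow2 a b : 2 ^+ Delta a b <= 2 :> K.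
  by rewrite /Delta; case: eqP => _; rewrite ?expr0 ?expr1 // ler1n.
have H n : 2 * \sum_(1 <= k < n.+1) growth k / k%:R <= 4 * growth n.
  rewrite sum_growth mulrA -natrM ler_pM2l ?ltr0n // gerBl //.
elim: r j => [|r IH] j /=.
  apply: le_trans (H j); rewrite mulr_sumr; apply: ler_sum => k _.
  rewrite -mulrA mulrC -mulrA; apply: ler_wpM2r; last exact: pow2.
  by rewrite divr_ge0 // growth_ge0.
under eq_bigr => l _ do rewrite mulr_sumr mulr_suml.
rewrite -(exchange_triangle 1 j.+1
  (fun k l => (l%:R)^-1 * (2 ^+ Delta j k / k%:R ^+ 1 * sharp k l (nseq r 1%N)) * growth l)).
rewrite exprSr -mulrA; apply: le_trans (ler_wpM2l _ (H j)); last first.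
  exact: exprn_ge0.
rewrite !mulr_sumr; apply: ler_sum => k _.
apply: le_trans (_ : (2 ^+ Delta j k / k%:R) * (4 ^+ r.+1 * growth k) <= _).
  apply: le_trans (ler_wpM2l _ (IH k)); last by rewrite divr_ge0 ?exprn_ge0.
  rewrite mulr_sumr; apply: ler_sum => l _; rewrite expr1.
  by rewrite le_eqVlt; apply/orP; left; apply/eqP; ring.
rewrite mulrCA; apply: ler_wpM2l; first exact: exprn_ge0.
rewrite -mulrA [_^-1 * _]mulrC; apply: ler_wpM2r; last exact: pow2.
by rewrite divr_ge0 // growth_ge0.
Qed.

Definition majorant (cs : seq nat) (i p k : nat) : K :=
  k%:R^-1 * sharp p k (nseq (nth 0%N cs i - 3) 1%N).

Lemma majorant_ge0 cs i p k : 0 <= majorant cs i p k.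
Proof. by rewrite mulr_ge0 ?invr_ge0 ?sharp_ge0. Qed.

(** One application of [sharp_growth] for each index of the chain. *)
Lemma nest_majorant cs d :
  exists2 C : K, 0 <= C & forall n, nest (majorant cs) d n n <= C * growth n.
Proof.
elim: d cs => [|d IH] cs.
  by exists 1 => // n; rewrite mul1r growth_ge1.
have [C C0 HC] := IH (behead cs).
exists (C * 4 ^+ (nth 0%N cs 0 - 3).+1) => [|n /=].
  by rewrite mulr_ge0 ?exprn_ge0.
rewrite -mulrA; apply: le_trans (ler_wpM2l C0 (sharp_growth n _)).
rewrite mulr_sumr; apply: ler_sum => k _.
rewrite -/(majorant cs 0 n k) mulrCA; apply: ler_wpM2l; first exact: majorant_ge0.
rewrite (eq_nest (g := majorant (behead cs))) // => i q j _ _.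
by rewrite /majorant nth_behead.
Qed.

Lemma sum_majorant cs d : exists C : K, forall n,
  \sum_(t <- chains d.+1 n) ((thead t)%:R ^+ 2)^-1 *
    (2 * \prod_(i < d) majorant cs i (nth 0%N t i) (nth 0%N t i.+1)) <= C.
Proof.
have [C C0 HC] := nest_majorant cs d.
exists (2 * C * 6) => n; rewrite sum_chains.
apply: le_trans (ler_wpM2l _ (sum_growth2 n)); last by rewrite mulr_ge0.
rewrite mulr_sumr; apply: ler_sum => k _.
apply: le_trans (_ : (k%:R ^+ 2)^-1 * (2 * nest (majorant cs) d k k) <= _).
  rewrite -sum_chains_prod !mulr_sumr; apply: ler_sum => t _; rewrite theadE.
  by rewrite le_eqVlt; apply/orP; left; apply/eqP; congr (_ * (_ * _));
     apply: eq_bigr => i _; rewrite (tnth_nth 0%N).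
rewrite mulrA [leRHS]mulrA [leRHS]mulrC -!mulrA.
apply: ler_wpM2l; first by rewrite invr_ge0 exprn_ge0.
by rewrite ler_pM2l // mulrC HC.
Qed.

End Growth.

Arguments growth {K} n : simpl never.

(** * Unconditional summation *)

Section Unconditional.
Context {T : choiceType} {K : numFieldType}.
Implicit Types (f g : T -> K) (I J : {fset T}).

(** Convergence of the net of finite partial sums, in a form that serves real
    and complex families alike. *)
Definition hassum f (L : K) : Prop := forall e : K, 0 < e ->
  exists J, forall I, (J `<=` I)%fset -> `|L - \sum_(x <- I) f x| < e.

Lemma sum_fsubset f J I : (J `<=` I)%fset ->
  \sum_(x <- I) f x = \sum_(x <- J) f x + \sum_(x <- I | x \notin J) f x.
Proof.
move=> JI; rewrite (bigID (mem J)) /=; congr (_ + _).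
rewrite -big_filter; apply: perm_big; apply: uniq_perm.
- exact/filter_uniq/fset_uniq.
- exact: fset_uniq.
- move=> x; rewrite mem_filter; case xJ: (x \in J) => //=.
  exact: (fsubsetP JI).
Qed.

Lemma hassumD f g L M : hassum f L -> hassum g M ->
  hassum (fun x => f x + g x) (L + M).
Proof.
move=> fL gM e e0; have e2 : 0 < e / 2 by rewrite divr_gt0.
have [J HJ] := fL _ e2; have [J' HJ'] := gM _ e2.
exists (J `|` J')%fset => I; rewrite fsubUset => /andP[/HJ H1 /HJ' H2].
rewrite big_split /= opprD addrACA [e]splitr.
exact: le_lt_trans (ler_normD _ _) (ltrD H1 H2).
Qed.

Lemma hassumZ f L a : hassum f L -> hassum (fun x => a * f x) (a * L).
Proof.
move=> fL e e0; have a1 : 0 < `|a| + 1 by rewrite ltr_wpDl.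
have [J HJ] := fL _ (divr_gt0 e0 a1); exists J => I /HJ H.
rewrite -mulr_sumr -mulrBr normrM.
apply: le_lt_trans (_ : _ <= (`|a| + 1) * `|L - \sum_(x <- I) f x|) _.
  by apply: ler_wpM2r => //; rewrite lerDl.
by rewrite mulrC -ltr_pdivlMr.
Qed.

Lemma hassum_finite (J : {fset T}) f : (forall x, x \notin J -> f x = 0) ->
  hassum f (\sum_(x <- J) f x).
Proof.
move=> f0 e e0; exists J => I JI; rewrite (sum_fsubset _ JI).
by rewrite [X in _ - (_ + X)]big1 ?addr0 ?subrr ?normr0 // => x /f0.
Qed.

Lemma eq_hassum f g L : f =1 g -> hassum f L -> hassum g L.
Proof.
move=> fg fL e /fL[J HJ]; exists J => I /HJ.
by under eq_bigr do rewrite fg.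
Qed.

Lemma hassum_sum (I : Type) (r : seq I) (F : I -> T -> K) (L : I -> K) :
  (forall i, hassum (F i) (L i)) ->
  hassum (fun x => \sum_(i <- r) F i x) (\sum_(i <- r) L i).
Proof.
move=> FL; elim: r => [|i r IH].
  rewrite big_nil; have := @hassum_finite fset0 (fun=> 0) (fun _ _ => erefl).
  by rewrite big_seq_fset0; apply: eq_hassum => x; rewrite big_nil.
rewrite big_cons; apply: eq_hassum (hassumD (FL i) IH) => x.
by rewrite big_cons.
Qed.

End Unconditional.

Section RealComplex.
Context {R : realType} {T : choiceType}.
Implicit Types (I J : {fset T}).

Lemma ler_sum_fsubset (f : T -> R) J I : (forall x, 0 <= f x) ->
  (J `<=` I)%fset -> \sum_(x <- J) f x <= \sum_(x <- I) f x.
Proof.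
by move=> f0 JI; rewrite (sum_fsubset f JI) lerDl sumr_ge0.
Qed.

(** The sum is the supremum of the finite partial sums. *)
Lemma hassum_nonneg (f : T -> R) (M : R) : (forall x, 0 <= f x) ->
  (forall I, \sum_(x <- I) f x <= M) -> exists L, hassum f L.
Proof.
move=> f0 fM; pose E := [set \sum_(x <- I) f x | I in [set: {fset T}]].
have supE : has_sup E.
  split; first by exists (\sum_(x <- fset0) f x), fset0.
  by exists M => _ [I _ <-].
exists (sup E) => e e0; have [_ [J _ <-] HJ] := sup_adherent e0 supE.
exists J => I JI; have sI : \sum_(x <- I) f x <= sup E.
  by apply: ub_le_sup; [exact: supE.2 | exists I].
rewrite ger0_norm ?subr_ge0 //; have := ler_sum_fsubset f0 JI; lra.
Qed.

Lemma hassum_ge (f : T -> R) L I : (forall x, 0 <= f x) -> hassum f L ->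
  \sum_(x <- I) f x <= L.
Proof.
move=> f0 fL; rewrite leNgt; apply/negP => LI.
have e0 : 0 < \sum_(x <- I) f x - L by rewrite subr_gt0.
have [J /(_ (I `|` J)%fset (fsubsetUr _ _))] := fL _ e0.
have := ler_sum_fsubset f0 (fsubsetUl I J).
rewrite ltr_norml => H1 /andP[H2 _]; lra.
Qed.

(** Both |f| + f and |f| - f are nonnegative with bounded partial sums. *)
Lemma hassum_abs_real (f : T -> R) (M : R) :
  (forall I, \sum_(x <- I) `|f x| <= M) -> exists L, hassum f L.
Proof.
move=> fM; have pos s : `|s| = 1 -> exists L, hassum (fun x => `|f x| + s * f x) L.
  move=> s1; apply: (@hassum_nonneg _ (M + M)) => [x|I].
    have := ler_norm (- (s * f x)); rewrite normrN normrM s1 mul1r; lra.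
  rewrite big_split /=; apply: lerD => //.
  apply: le_trans (fM I); apply: ler_sum => x _.
  by apply: le_trans (ler_norm _) _; rewrite normrM s1 mul1r.
have [L HL] := pos 1 (normr1 _).
have [L' HL'] := pos (-1) (normrN1 _).
exists (2^-1 * (L + -1 * L')).
apply: eq_hassum (hassumZ 2^-1 (hassumD HL (hassumZ (-1) HL'))) => x.
by field.
Qed.

Local Notation C := R[i].

Lemma ltc0_real (e : C) : 0 < e -> exists2 r : R, 0 < r & e = r%:C.
Proof.
rewrite ltcE => /andP[/eqP im re]; exists (Re e) => //.
by rewrite [LHS]complexE im mulr0 addr0.
Qed.

Lemma normc_real (x : R) : `|x%:C| = `|x|%:C :> C.
Proof. by rewrite normc_def /= expr0n addr0 sqrtr_sqr. Qed.

Lemma ler_Re_norm (z : C) : `|Re z| <= Re `|z|.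
Proof.
by rewrite normc_def /= -sqrtr_sqr ler_wsqrtr // lerDl sqr_ge0.
Qed.

Lemma ler_Im_norm (z : C) : `|Im z| <= Re `|z|.
Proof.
by rewrite normc_def /= -sqrtr_sqr ler_wsqrtr // lerDr sqr_ge0.
Qed.

Lemma norm_ReE (z : C) : (Re `|z|)%:C = `|z|.
Proof. by rewrite RRe_real // normr_real. Qed.

Lemma Re_norm_ge0 (z : C) : 0 <= Re `|z|.
Proof. by rewrite -ler0c norm_ReE. Qed.

Lemma ltc_norm (z : C) (r : R) : (`|z| < r%:C) = (Re `|z| < r).
Proof. by rewrite -[in LHS]norm_ReE ltcR. Qed.

Lemma hassum_real (f : T -> R) L : hassum f L ->
  hassum (fun x => (f x)%:C : C) L%:C.
Proof.
move=> fL e /ltc0_real[r r0 ->]; have [J HJ] := fL _ r0; exists J => I /HJ.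
by rewrite -rmorph_sum -rmorphB normc_real ltcR.
Qed.

Lemma hassum_real_ge (f : T -> R) (L : C) (I : {fset T}) :
  (forall x, 0 <= f x) -> hassum (fun x => (f x)%:C) L ->
  \sum_(x <- I) f x <= Re L.
Proof.
move=> f0 fL; apply: hassum_ge f0 _ => e e0.
have [J HJ] := fL e%:C (etrans (ltcR _ _) e0); exists J => K /HJ.
rewrite ltc_norm; apply: le_lt_trans; apply: le_trans (ler_Re_norm _).
by rewrite -rmorph_sum raddfB.
Qed.

Lemma hassum_abs (f : T -> C) (M : R) :
  (forall I, \sum_(x <- I) Re `|f x| <= M) -> exists L, hassum f L.
Proof.
move=> fM; have re : exists L, hassum (fun x => Re (f x)) L.
  apply: (@hassum_abs_real _ M) => I; apply: le_trans (fM I).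
  by apply: ler_sum => x _; exact: ler_Re_norm.
have im : exists L, hassum (fun x => Im (f x)) L.
  apply: (@hassum_abs_real _ M) => I; apply: le_trans (fM I).
  by apply: ler_sum => x _; exact: ler_Im_norm.
have [[L HL] [L' HL']] := (re, im).
exists (L%:C + 'i * L'%:C).
apply: eq_hassum (hassumD (hassum_real HL) (hassumZ 'i (hassum_real HL'))) => x.
by rewrite -complexE.
Qed.

(** The point is that J depends on the majorant g only, so that it serves a
    whole sequence of families at once. *)
Lemma hassum_tail (g : T -> R) (M : R) : (forall x, 0 <= g x) ->
  (forall I, \sum_(x <- I) g x <= M) ->
  forall e : R, 0 < e -> exists J, forall (f : T -> C) L,
    (forall x, Re `|f x| <= g x) -> hassum f L ->
    Re `|L - \sum_(x <- J) f x| < e.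
Proof.
move=> g0 gM e e0; have [G HG] := hassum_nonneg g0 gM.
have e2 : 0 < e / 2 by rewrite divr_gt0.
have [J HJ] := HG _ e2; exists J => f L fg fL.
have [J' HJ'] := fL (e / 2)%:C (etrans (ltcR _ _) e2).
have {HJ'} := HJ' (J `|` J')%fset (fsubsetUr _ _).
have JU : (J `<=` J `|` J')%fset by exact: fsubsetUl.
set U := (J `|` J')%fset in JU *.
rewrite ltc_norm => H1.
have H2 : Re `|\sum_(x <- U) f x - \sum_(x <- J) f x| < e / 2.
  rewrite (sum_fsubset f JU) addrAC subrr add0r.
  apply: le_lt_trans (_ : \sum_(x <- U | x \notin J) g x < _).
    rewrite -lecR norm_ReE; apply: le_trans (ler_norm_sum _ _ _) _.
    rewrite rmorph_sum; apply: ler_sum => x _.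
    by rewrite -norm_ReE lecR.
  have := HJ J (fsubset_refl J); have := hassum_ge U g0 HG.
  rewrite (sum_fsubset g JU) => H3 /ltr_normlW H4; lra.
rewrite [e]splitr -ltc_norm; apply: le_lt_trans (ler_distD (\sum_(x <- U) f x) _ _) _.
by rewrite rmorphD; apply: ltrD; rewrite ltc_norm.
Qed.

Lemma cvg_sum_seq (I : Type) (r : seq I) (u : I -> nat -> R) (l : I -> R) :
  (forall i, u i n @[n --> \oo] --> l i) ->
  \sum_(i <- r) u i n @[n --> \oo] --> \sum_(i <- r) l i.
Proof.
move=> ul; elim: r => [|i r IH].
  rewrite big_nil; under eq_fun do rewrite big_nil; exact: cvg_cst.
rewrite big_cons; under eq_fun do rewrite big_cons.
exact: cvgD.
Qed.

(** Dominated convergence for weights increasing to a limit.  The uniform bound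
    on the partial sums passes to the limit weights, which then provide the
    majorant for [hassum_tail]; on the finite set that it gives, convergence is
    pointwise. *)
Lemma hassum_monotone_weights (s : nat -> T -> R) (S : T -> R) (g : T -> C)
    (L : nat -> C) (M : R) :
  (forall n x, 0 <= s n x <= S x) ->
  (forall x, s n x @[n --> \oo] --> S x) ->
  (forall n I, \sum_(x <- I) s n x * Re `|g x| <= M) ->
  (forall n, hassum (fun x => (s n x)%:C * g x) (L n)) ->
  exists2 L0, hassum (fun x => (S x)%:C * g x) L0
    & forall e : R, 0 < e -> \forall n \near \oo, Re `|L n - L0| < e.
Proof.
move=> s0S sS sM sL.
pose a x := Re `|g x|; have a0 x : 0 <= a x by exact: Re_norm_ge0.
have S0 x : 0 <= S x by have /andP[] := s0S 0%N x; exact: le_trans.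
have nE (r : R) x : 0 <= r -> Re `|r%:C * g x| = r * a x.
  by move=> r0; rewrite normrM normc_real (ger0_norm r0) -norm_ReE -rmorphM.
have SM I : \sum_(x <- I) S x * a x <= M.
  have : \sum_(x <- I) s n x * a x @[n --> \oo] --> \sum_(x <- I) S x * a x.
    by apply: cvg_sum_seq => x; apply: cvgMl; exact: sS.
  move=> H; rewrite -(cvg_lim _ H) //; apply: limr_le; first by apply/cvg_ex; exists (\sum_(x <- I) S x * a x).
  by near=> n; exact: sM.
have g0 x : 0 <= S x * a x by exact: mulr_ge0.
have [L0 HL0] : exists L, hassum (fun x => (S x)%:C * g x) L.
  by apply: (@hassum_abs _ M) => I; under eq_bigr do rewrite nE //.
exists L0 => // e e0.
have e3 : 0 < e / 3 by rewrite divr_gt0.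
have [J HJ] := hassum_tail g0 SM e3.
have H0 : Re `|L0 - \sum_(x <- J) (S x)%:C * g x| < e / 3.
  by apply: HJ => // x; rewrite nE.
have Hn n : Re `|L n - \sum_(x <- J) (s n x)%:C * g x| < e / 3.
  apply: HJ => // x; have /andP[s0 sS'] := s0S n x; rewrite nE //.
  exact: ler_wpM2r.
have : \sum_(x <- J) s n x * a x @[n --> \oo] --> \sum_(x <- J) S x * a x.
  by apply: cvg_sum_seq => x; apply: cvgMl; exact: sS.
move/cvgrPdist_lt/(_ _ e3); apply: filterS => n Hd.
have H1 : Re `|\sum_(x <- J) (s n x)%:C * g x - \sum_(x <- J) (S x)%:C * g x| < e / 3.
  apply: le_lt_trans Hd; rewrite -!sumrB [leRHS]ger0_norm; last first.
    apply: sumr_ge0 => x _; rewrite -mulrBl mulr_ge0 // subr_ge0.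
    by have /andP[] := s0S n x.
  rewrite -lecR norm_ReE; apply: le_trans (ler_norm_sum _ _ _) _.
  rewrite rmorph_sum; apply: ler_sum => x _.
  have /andP[_ sS'] := s0S n x.
  by rewrite distrC -mulrBl -rmorphB -[leLHS]norm_ReE nE ?subr_ge0 // mulrBl.
have -> : e = e / 3 + e / 3 + e / 3 by field.
rewrite -ltc_norm.
apply: le_lt_trans (ler_distD (\sum_(x <- J) (S x)%:C * g x) _ _) _.
apply: le_lt_trans (lerD (ler_distD (\sum_(x <- J) (s n x)%:C * g x) _ _) (lexx _)) _.
by rewrite !rmorphD; do 2?[apply: ltrD]; rewrite ltc_norm // distrC.
Unshelve. all: by end_near. Qed.

End RealComplex.

(** * Sharp sums as recursive sums *)

Section SharpSum.

(** The bound on the entries of the tuple is fixed to some N >= k in the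
    induction, because peeling the largest index lowers k but not the type of
    the remaining tuple. *)
Lemma sharp_sumE (R : realType) (k m : nat) (r : seq nat) :
  (m <= k)%N -> sharp_sum R k m r = sharp k m r.
Proof.
have H N : forall k', (m <= k' <= N)%N ->
    \sum_(l : (size r).-tuple 'I_N.+1 | path geq k' (rcons (map val l) m))
      2 ^+ jumps k' (map val l) m
      / \prod_(i < size r) (tnth l i : nat)%:R ^+ nth 0%N r i = sharp k' m r :> R.
  elim: r => [|s r IH] k' /andP[mk kN].
    rewrite (big_pred1 [tuple]) => [|l] /=; last first.
      by rewrite [l]tuple0 /= mk; apply/esym/eqP.
    by rewrite big_ord0 divr1 /jumps /= big_seq1.
  rewrite (reindex (fun p : 'I_N.+1 * (size r).-tuple 'I_N.+1 => [tuple of p.1 :: p.2])) /=; last first.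
    exists (fun t : (size r).+1.-tuple 'I_N.+1 => (thead t, [tuple of behead t])).
      by move=> [x t] _ /=; rewrite theadE; congr (_, _); apply: val_inj.
    by move=> t _ /=; rewrite -tuple_eta.
  transitivity (\sum_(x : 'I_N.+1 | (x <= k')%N)
    \sum_(l : (size r).-tuple 'I_N.+1 | path geq x (rcons (map val l) m))
       2 ^+ Delta k' x / x%:R ^+ s * (2 ^+ jumps x (map val l) m
        / \prod_(i < size r) (tnth l i : nat)%:R ^+ nth 0%N r i) : R).
    rewrite pair_big_dep /=; apply: eq_big => [[x l] //|[x l] _] /=.
    rewrite /jumps /= big_cons exprD big_ord_recl /= invfM mulrACA.
    by congr (_ * (_ / _)); apply: eq_bigr => i _; rewrite tnthS.
  rewrite (big_nat_widen _ _ N.+1) ?ltnS // big_geq_mkord.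
  rewrite big_mkcond [RHS]big_mkcond; apply: eq_bigr => x _ /=.
  rewrite ltnS; case: leqP => //= xk; case: leqP => mx.
    by rewrite -mulr_sumr IH // mx (leq_trans xk).
  rewrite big_pred0 // => l; apply/negP => pl.
  have geq_trans : transitive geq by move=> u v w vu uw; exact: leq_trans uw vu.
  have /allP/(_ m) := order_path_min geq_trans pl.
  by rewrite mem_rcons mem_head /= => /(_ isT); rewrite leqNgt mx.
move=> mk; rewrite /sharp_sum ltnNge mk orbF; case: r H => [|s r] H //.
by apply: (H k k); rewrite mk leqnn.
Qed.

Lemma sharp_rmorph (K L : numFieldType) (f : {rmorphism K -> L}) k m r :
  f (sharp k m r) = sharp k m r.
Proof.
elim: r k => [|s r IH] k /=; first by rewrite rmorphXn rmorph_nat.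
rewrite rmorph_sum; apply: eq_bigr => l _.
by rewrite rmorphM fmorph_div !rmorphXn !rmorph_nat IH.
Qed.

Lemma beta_rmorph (K L : numFieldType) (f : {rmorphism K -> L}) n k :
  f (beta n k) = beta n k.
Proof.
elim: k => [|k IH]; first by rewrite rmorph1.
by rewrite /beta -/beta rmorphM IH fmorph_div rmorphB !rmorph_nat.
Qed.

Lemma sstar_rmorph (K L : numFieldType) (f : {rmorphism K -> L}) n s :
  f (sstar n s) = sstar n s.
Proof.
elim: s n => [|a s IH] n /=; first by rewrite rmorph1.
rewrite rmorph_sum; apply: eq_bigr => k _.
by rewrite rmorphM fmorphV rmorphXn rmorph_nat IH.
Qed.

End SharpSum.

(** * Unconditional sums as limits of nets *)

Section Bridge.
Context {R : realType}.
Local Notation C := R[i].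

Lemma csum_hassum (T : choiceType) (D : set T) (f : T -> C) (L : C) :
  hassum (patch (fun=> 0) D f) L -> csummable D f /\ csum D f = L.
Proof.
move=> fL; rewrite /csummable /csum /summability.sum.
have PF := @summability.totally_filter T.
set g : T -> R[i]^o := patch _ _ _.
have H : summability.partial_sum g @ summability.totally --> (L : R[i]^o).
  apply/cvgrPdist_lt => e e0; have [J HJ] := fL _ e0.
  exists J => // I /= JI; rewrite /summability.partial_sum -(big_seq_fsetE _ _ predT g).
  exact: HJ.
split; first by apply/cvg_ex; exists L.
have HH := @norm_hausdorff _ (R[i]^o).
exact: (cvg_lim HH H).
Qed.

Lemma patch_indicator (T : choiceType) (D : set T) (b : pred T) (f : T -> C) :
  (forall x, D x <-> b x) ->
  patch (fun=> 0) D f = (fun x => (if b x then 1 else 0 : R)%:C * f x).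
Proof.
move=> Db; apply/funext => x; rewrite /patch.
have -> : (x \in D) = b x by apply/idP/idP; rewrite inE => /Db.
by case: (b x); rewrite ?mul1r ?mul0r.
Qed.

End Bridge.

(** * Products of one-variable series *)

Section Box.
Context {R : realType}.
Local Notation C := R[i].

Fixpoint box (d N : nat) : seq (d.-tuple nat) :=
  if d is d'.+1 then
    [seq [tuple of k :: t] | k : nat <- index_iota 0 N, t : d'.-tuple nat <- box d' N]
  else [:: [tuple]].

Lemma mem_box d N (t : d.-tuple nat) : (t \in box d N) = all (fun x => (x < N)%N) t.
Proof.
elim: d t => [|d IH] t; first by rewrite tuple0 mem_seq1 eqxx.
case/tupleP: t => x t /=; apply/allpairsP/idP.
  move=> [[k u] /= [kn ut e]]; have [-> ->] : x = k /\ t = u.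
    by move/(congr1 val): e => /= -[-> /val_inj ->].
  by move: kn ut; rewrite mem_index_iota IH => /= -> ->.
move=> /andP[xN tN]; exists (x, t); split => //=.
  by rewrite mem_index_iota.
by rewrite IH.
Qed.

Lemma box_uniq d N : uniq (box d N).
Proof.
elim: d => [|d IH] //=; apply: allpairs_uniq => //; first exact: iota_uniq.
by move=> [x t] [y u] _ _ /= /(congr1 val) /= -[-> /val_inj ->].
Qed.

Lemma sum_box (K : numFieldType) d N (u : nat -> nat -> K) :
  \sum_(t <- box d N) \prod_(i < d) u i (tnth t i)
  = \prod_(i < d) \sum_(0 <= x < N) u i x.
Proof.
elim: d u => [|d IH] u; first by rewrite big_seq1 !big_ord0.
rewrite big_allpairs_dep /= big_ord_recl /= -(IH (fun i => u i.+1)) mulr_suml.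
apply: eq_bigr => x _; rewrite mulr_sumr; apply: eq_bigr => t _.
by rewrite big_ord_recl; congr (_ * _); apply: eq_bigr => i _; rewrite tnthS.
Qed.

Lemma sum_fset_seq (K : numFieldType) (T : choiceType) (s : seq T) (f : T -> K) :
  uniq s -> \sum_(x <- [fset x in s]%fset) f x = \sum_(x <- s) f x.
Proof.
move=> us; apply/perm_big/uniq_perm => //.
by move=> x; rewrite inE.
Qed.

(** The sum of all entries bounds each of them. *)
Lemma box_exhausts d (J : {fset d.-tuple nat}) :
  \forall N \near \oo, (J `<=` [fset t in box d N])%fset.
Proof.
exists (\sum_(t <- J) (sumn t).+1)%N => // N /= JN; apply/fsubsetP => t tJ.
rewrite inE mem_box; apply/allP => x xt; apply: leq_trans JN.
rewrite (big_rem t) //=; apply: leq_trans (leq_addr _ _).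
by rewrite ltnS; elim: (tval t) xt => //= y s IH; rewrite inE => /orP[/eqP ->|/IH];
   rewrite ?leq_addr // => /leq_trans; apply; rewrite leq_addl.
Qed.

Lemma near_prod_seq (K : numFieldType) d (u : nat -> nat -> K) (U : nat -> K) :
  (forall i, (i < d)%N -> forall e, 0 < e -> \forall N \near \oo, `|U i - u i N| < e) ->
  forall e, 0 < e ->
    \forall N \near \oo, `|\prod_(i < d) U i - \prod_(i < d) u i N| < e.
Proof.
move=> uU; apply/cvgrPdist_lt; elim: d uU => [|d IH] uU.
  by rewrite big_ord0; under eq_fun do rewrite big_ord0; exact: cvg_cst.
rewrite big_ord_recr; under eq_fun do rewrite big_ord_recr.
apply: cvgM; first by apply: IH => i id; apply: uU; exact: ltnW.
by apply/cvgrPdist_lt; exact: uU.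
Qed.

(** The sum exists by absolute convergence, since every finite set of indices
    lies in a box; its value is read off along boxes, on which the sum of the
    products is the product of the sums. *)
Lemma hassum_prod d (u : nat -> nat -> C) (U : nat -> C) (B : nat -> R) :
  (forall i N, (i < d)%N -> \sum_(0 <= x < N) Re `|u i x| <= B i) ->
  (forall i, (i < d)%N -> forall e, 0 < e ->
     \forall N \near \oo, `|U i - \sum_(0 <= x < N) u i x| < e) ->
  hassum (fun a : d.-tuple nat => \prod_(i < d) u i (tnth a i)) (\prod_(i < d) U i).
Proof.
move=> uB uU; set f := fun _ => _.
have [L HL] : exists L, hassum f L.
  apply: (@hassum_abs _ _ _ (\prod_(i < d) B i)) => I.
  have [N _ /(_ N (leqnn N)) /= IN] := box_exhausts I.
  apply: le_trans (ler_sum_fsubset _ IN) _.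
    by move=> x; exact: Re_norm_ge0.
  rewrite sum_fset_seq ?box_uniq //.
  rewrite (eq_bigr (fun t => \prod_(i < d) Re `|u i (tnth t i)|)); last first.
    move=> t _; apply: (@complexI R); rewrite norm_ReE normr_prod rmorph_prod.
    by apply: eq_bigr => i _; exact/esym/norm_ReE.
  rewrite (sum_box d N (fun i x => Re `|u i x|)).
  apply: ler_prod => i _; rewrite uB // andbT.
  by apply: sumr_ge0 => x _; exact: Re_norm_ge0.
suff -> : \prod_(i < d) U i = L by [].
apply/eqP; rewrite -subr_eq0 -normr_eq0; apply/negPn/negP => LL.
have e0 : 0 < `|\prod_(i < d) U i - L| / 2 by rewrite divr_gt0 // lt_def LL normr_ge0.
have [J HJ] := HL _ e0.
have [N _ /(_ N (leqnn N)) /= [JN]] : \forall N \near \oo, (J `<=` [fset t in box d N])%fset /\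
    `|\prod_(i < d) U i - \prod_(i < d) \sum_(0 <= x < N) u i x| < `|\prod_(i < d) U i - L| / 2.
  by apply: filterI; [exact: box_exhausts | exact: (near_prod_seq uU)].
have := HJ _ JN; rewrite sum_fset_seq ?box_uniq // sum_box distrC.
move=> H1 H2; have := ltrD H2 H1; rewrite -splitr => H.
by have := le_lt_trans (ler_distD _ _ _) H; rewrite ltxx.
Qed.

End Box.

(** * Geometric series in several variables *)

Section Geometric.
Context {R : realType}.
Local Notation C := R[i].

Lemma geometric_sum (q : C) N : q != 1 ->
  \sum_(0 <= x < N) q ^+ x = (1 - q ^+ N) / (1 - q).
Proof.
move=> q1; have q1' : 1 - q != 0 by rewrite subr_eq0 eq_sym.
apply: (mulIf q1'); rewrite divfK // big_mkord mulrC.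
by rewrite -[1 - q]opprB mulNr -subrX1 opprB.
Qed.

Lemma near_geometric (q c : C) : `|q| < 1 ->
  forall e, 0 < e -> \forall N \near \oo, `|q ^+ N * c| < e.
Proof.
move=> q1 _ /ltc0_real[r r0 ->].
have rho1 : `|Re `|q| | < 1.
  by rewrite ger0_norm ?Re_norm_ge0 // -ltcR norm_ReE rmorph1.
have c1 : 0 < Re `|c| + 1 by rewrite ltr_wpDl ?Re_norm_ge0.
have /cvgrPdist_lt/(_ _ (divr_gt0 r0 c1)) := cvg_expr rho1.
apply: filterS => N; rewrite sub0r normrN normrX ger0_norm ?Re_norm_ge0 // => H.
rewrite normrM normrX -(norm_ReE q) -(norm_ReE c) -rmorphXn -rmorphM ltcR.
apply: le_lt_trans (_ : Re `|q| ^+ N * (Re `|c| + 1) < _).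
  by rewrite ler_wpM2l ?exprn_ge0 ?Re_norm_ge0 // lerDl.
by rewrite -ltr_pdivlMr.
Qed.

(** Excluding exponent 0 in the variable of index m removes the leading 1 of
    that geometric series, leaving q_m / (1 - q_m). *)
Lemma hassum_geometric d (q : nat -> C) m : (forall i, (i < d)%N -> `|q i| < 1) ->
  hassum (fun a : d.-tuple nat => \prod_(i < d)
      (if (i == m :> nat) && (tnth a i == 0%N) then 0 else q i ^+ tnth a i))
    (\prod_(i < d) (q i ^+ (i == m :> nat) / (1 - q i))).
Proof.
move=> q1; pose u i x := if (i == m :> nat) && (x == 0%N) then 0 else q i ^+ x.
pose U i := q i ^+ (i == m :> nat) / (1 - q i).
have rho1 i : (i < d)%N -> Re `|q i| < 1.
  by move=> id; rewrite -ltc_norm rmorph1; exact: q1.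
apply: (@hassum_prod _ d u U (fun i => (1 - Re `|q i|)^-1)) => i.
  move=> N /rho1 r1; set rho := Re _ in r1 *.
  have rho0 : 0 <= rho by exact: Re_norm_ge0.
  apply: le_trans (_ : \sum_(0 <= x < N) rho ^+ x <= _).
    apply: ler_sum => x _; rewrite /u; case: ifP => _.
      by rewrite normr0 exprn_ge0.
    by rewrite -lecR norm_ReE normrX -(norm_ReE (q i)) rmorphXn.
  rewrite -[leRHS]mul1r ler_pdivlMr ?subr_gt0 // big_mkord mulrC.
  by rewrite -[1 - rho]opprB mulNr -subrX1 opprB gerBl exprn_ge0.
move=> id; have qi1 := q1 i id.
have qn1 : q i != 1.
  by apply: contraTneq qi1 => ->; rewrite normr1 ltxx.
have q1' : 1 - q i != 0 by rewrite subr_eq0 eq_sym.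
move=> e e0; have := near_geometric (1 - q i)^-1 qi1 e0.
case=> N0 _ HN; exists N0.+1 => // N /= NN; have {HN} := HN N (ltnW NN).
suff -> : q i ^+ N / (1 - q i) = U i - \sum_(0 <= x < N) u i x by [].
case: N NN => // N _.
have -> : \sum_(0 <= x < N.+1) u i x
    = \sum_(0 <= x < N.+1) q i ^+ x - (i == m)%:R.
  rewrite !big_nat_recl // /u eqxx andbT expr0.
  under eq_bigr do rewrite andbF.
  by case: (i == m); rewrite /= ?subr0 // [RHS]addrC addrA addNr.
rewrite geometric_sum // /U; case: (i == m) => /=; rewrite ?expr1 ?expr0.
  by rewrite mulr1n; field.
by rewrite mulr0n subr0; field.
Qed.

End Geometric.

(** * Limits of the truncated star sums and of the weights *)

Section ZetaStar.
Context {R : realType}.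

Lemma chains_mono d n n' : (n <= n')%N -> {subset chains d n <= chains d n'}.
Proof.
move=> nn t; rewrite !mem_chains => /andP[pt ->]; rewrite andbT.
by case: (tval t) pt => //= x s /andP[xn ->]; rewrite (leq_trans xn nn).
Qed.

Lemma weakly_decreasing_chains d (t : d.-tuple nat) :
  weakly_decreasing d t <-> exists n, t \in chains d n.
Proof.
rewrite /weakly_decreasing /=; case: d t => [|d] t.
  by rewrite tuple0; split=> // _; exists 0%N; rewrite mem_chains.
split=> [st|[n]]; last by rewrite mem_chainsS => /andP[].
by exists (thead t); rewrite mem_chainsS st leqnn.
Qed.

Lemma chains_exhaust d (s : seq (d.-tuple nat)) :
  (forall t, t \in s -> weakly_decreasing d t) ->
  exists n, forall t, t \in s -> t \in chains d n.
Proof.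
elim: s => [|t s IH] H; first by exists 0%N.
have [u us|n Hn] := IH; first by apply: H; rewrite inE us orbT.
have /weakly_decreasing_chains[k Hk] := H t (mem_head _ _).
exists (maxn n k) => u; rewrite inE => /orP[/eqP ->|us].
  exact: chains_mono (leq_maxr _ _) _ Hk.
exact: chains_mono (leq_maxl _ _) _ (Hn _ us).
Qed.

Lemma sstar_ge0 n s : 0 <= sstar n s :> R.
Proof.
elim: s n => [|a s IH] n //=; apply: sumr_ge0 => k _.
by rewrite mulr_ge0 // invr_ge0 exprn_ge0.
Qed.

Lemma sstar_mono s : nondecreasing_seq (fun n => sstar n s : R).
Proof.
move=> n n' nn; case: s => [|a s] //=.
rewrite (big_cat_nat _ (_ : n.+1 <= n'.+1)%N) //= lerDl sumr_ge0 // => k _.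
by rewrite mulr_ge0 ?sstar_ge0 // invr_ge0 exprn_ge0.
Qed.

Lemma sstar_sum n s : sstar n s = \sum_(t <- chains (size s) n)
   \prod_(i < size s) ((tnth t i)%:R ^+ nth 0%N s i)^-1 :> R.
Proof. by rewrite sstar_nest -sum_chains_prod. Qed.

(** Every finite set of chains is contained in some [chains (size s) n].  The
    bound M makes the extended sum finite. *)
Lemma zeta_star_sup (s : seq nat) (M : R) : (forall n, sstar n s <= M) ->
  zeta_star R s = sup (range (fun n => sstar n s : R)).
Proof.
move=> sM; rewrite /zeta_star; set f := fun k => _; set S := sup _.
have supS : has_sup (range (fun n => sstar n s : R)).
  by split; [exists (sstar 0 s), 0%N | exists M => _ [n _ <-]].
have f0 k : (0 <= f k)%E.
  by rewrite lee_fin prodr_ge0 // => i _; rewrite invr_ge0 exprn_ge0.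
suff -> : esum (weakly_decreasing (size s)) f = S%:E by [].
apply/eqP; rewrite eq_le; apply/andP; split.
  apply: ub_ereal_sup => _ [A [finA AD] <-].
  rewrite fsbig_finite //= sumEFin lee_fin.
  have [n Hn] : exists n, forall t, t \in (fset_set A : seq _) -> t \in chains (size s) n.
    by apply: chains_exhaust => t; rewrite in_fset_set // inE => /AD.
  apply: le_trans (_ : sstar n s <= _); last first.
    by apply: ub_le_sup; [exact: supS.2 | exists n].
  rewrite sstar_sum -(sum_fset_seq _ (chains_uniq _ _)).
  apply: ler_sum_fsubset.
    by move=> k; rewrite prodr_ge0 // => i _; rewrite invr_ge0 exprn_ge0.
  by apply/fsubsetP => t /Hn; rewrite inE.
have leE n : ((sstar n s)%:E <= esum (weakly_decreasing (size s)) f)%E.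
  rewrite sstar_sum -sumEFin.
  apply: ereal_sup_ubound; exists [set` chains (size s) n].
    split; first exact: finite_seq.
    by move=> t /= tn; apply/weakly_decreasing_chains; exists n.
  by rewrite -fsbig_seq // chains_uniq.
have E0 : (0 <= esum (weakly_decreasing (size s)) f)%E by apply: esum_ge0 => k _; exact: f0.
case: (esum _ _) E0 leE => [x _ leE| |] //.
  rewrite lee_fin; apply: ge_sup; first exact: supS.1.
  by move=> _ [n _ <-]; rewrite -lee_fin.
by move=> *; rewrite leey.
Qed.

Lemma sstar_cvg (s : seq nat) (M : R) : (forall n, sstar n s <= M) ->
  sstar n s @[n --> \oo] --> zeta_star R s.
Proof.
move=> sM; rewrite (zeta_star_sup sM); apply: nondecreasing_cvgn.
  exact: sstar_mono.
by exists M => _ [n _ <-].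
Qed.

Lemma sstar_le_zeta (s : seq nat) (M : R) : (forall n, sstar n s <= M) ->
  forall n, sstar n s <= zeta_star R s.
Proof.
move=> sM n; rewrite (zeta_star_sup sM); apply: ub_le_sup; last by exists n.
by exists M => _ [k _ <-].
Qed.

(** The factor is 1 - (2 k + 1) / (n + k + 1). *)
Lemma beta_factor_cvg (k : nat) :
  (n%:R - k%:R) / (n + k.+1)%:R @[n --> \oo] --> (1 : R).
Proof.
have -> : (fun n : nat => (n%:R - k%:R) / (n + k.+1)%:R : R)
    = (fun n => 1 - (2 * k%:R + 1) * harmonic (n + k)%N).
  apply/funext => n; rewrite /harmonic /= addnS -natr1 natrD.
  by field; rewrite -natrD natr1 pnatr_eq0.
rewrite -[X in _ --> X]subr0 -[X in _ --> _ - X](mulr0 (2 * k%:R + 1)).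
apply: cvgB; first exact: cvg_cst.
by apply: cvgMr; rewrite (cvg_shiftn k (@harmonic R)); exact: cvg_harmonic.
Qed.

Lemma beta_cvg (k : nat) : beta n k @[n --> \oo] --> (1 : R).
Proof.
elim: k => [|k IH]; first exact: cvg_cst.
rewrite -[X in _ --> X]mulr1.
exact: (cvgM IH (beta_factor_cvg k)).
Qed.

End ZetaStar.

(** * Absolute convergence of the dual series *)

(** Here e_i stands for delta (c_i), so e_i <= 1 except at the end, where
    e_(d+1) = 2.  Only two exponents can exceed what is needed: the last index
    may carry an extra factor k_d, at most k_m, and the first one may carry
    k_0^2 rather than k_0, but only if m = 0, when k_m = k_0. *)
Lemma exponent_bound (d m : nat) (k e : nat -> nat) :
  (m <= d)%N -> (forall i, (i <= d)%N -> (0 < k d <= k i)%N) ->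
  e 0%N = 1%N -> (forall i, (i <= d)%N -> (e i <= 1)%N) -> (e d.+1 <= 2)%N ->
  ((0 < m)%N -> e 1%N = 0%N) ->
  (\prod_(i < d.+1) k i ^ (e i + e i.+1)
   <= k m ^ 2 * k 0 * \prod_(i < d) k i.+1 ^ 2)%N.
Proof.
move=> md kd e0 e1 e2 em.
have k0 i : (i <= d)%N -> (0 < k i)%N by move=> /kd /andP[]; exact: leq_trans.
have pw i a b : (i <= d)%N -> (a <= b)%N -> (k i ^ a <= k i ^ b)%N.
  by move=> /k0 ki ab; rewrite leq_pexp2l.
case: d md kd e1 e2 k0 pw => [|d] md kd e1 e2 k0 pw.
  have -> : m = 0%N by lia.
  rewrite big_ord1 big_ord0 muln1 -expnSr; apply: pw => //.
  by rewrite e0 ltnS.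
rewrite big_ord_recl [in leqRHS]big_ord_recr big_ord_recr /= e0 /bump /=.
rewrite [leqRHS](_ : _ = (k m * k 0) * ((\prod_(i < d) k i.+1 ^ 2) * (k d.+1 ^ 2 * k m)))%N; last first.
  by rewrite -mulnn; ring.
apply: leq_mul; last apply: leq_mul.
- have [m0|m0] := posnP m.
    by rewrite m0 mulnn; apply: pw => //; rewrite add1n ltnS e1.
  by rewrite em // addn0 expn1 leq_pmull // k0.
- apply: leq_prod => i _; apply: pw; first by rewrite ltnW // ltnS.
  by apply: (leq_add (e1 _ _) (e1 _ _)); have := ltn_ord i; lia.
- apply: leq_trans (_ : k d.+1 ^ 3 <= _)%N.
    by apply: pw => //; apply: (leq_add (e1 _ _) e2).
  by rewrite expnS mulnC leq_mul2l; have /andP[_ ->] := kd m md; rewrite orbT.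
Qed.

Section SharpTerm.
Context {R : realType} {d : nat}.
Local Notation C := R[i].
Variables (c : d.-tuple nat) (m : 'I_d.+1).
Hypothesis hc : forall i : 'I_d, (0 < tnth c i)%N /\ tnth c i <> 2%N.
Hypothesis hc1 : (0 < m)%N -> (3 <= nth 0%N c 0)%N.

Lemma chains_nth n (t : d.+1.-tuple nat) i j : t \in chains d.+1 n ->
  (i <= j <= d)%N -> (0 < nth 0%N t j <= nth 0%N t i)%N.
Proof.
rewrite mem_chains => /andP[pt t0] /andP[ij jd]; apply/andP; split.
  by have /all_nthP := t0; apply; rewrite size_tuple ltnS.
have geq_trans : transitive geq by move=> u v w vu uw; exact: leq_trans uw vu.
have st : sorted geq t by exact: path_sorted pt.
apply: (sorted_leq_nth geq_trans leqnn 0%N st) => //; rewrite inE size_tuple ltnS //.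
exact: leq_trans ij jd.
Qed.

Lemma chains_gt0 n (t : d.+1.-tuple nat) (i : 'I_d.+1) :
  t \in chains d.+1 n -> (0 < tnth t i)%N.
Proof.
move=> tn; rewrite (tnth_nth 0%N).
have ii : (i <= i <= d)%N by rewrite leqnn /= -ltnS.
by case/andP: (chains_nth tn ii).
Qed.

Lemma cextE i : cext c i = nth 0%N (1%N :: c) i.
Proof.
rewrite /cext; case: i => //= i; rewrite nth_rcons; case: ltnP => // ci.
by rewrite nth_default //; case: eqP.
Qed.

(** The list 1 :: c supplies c_0 = 1, and the default value 0 of [nth] supplies
    c_(d+1); likewise 0 :: t supplies k_(-1) = 0. *)
Definition chain_link (t : d.+1.-tuple nat) (i : 'I_d.+1) : C :=
  link (nth 0%N (1%N :: c) i) (nth 0%N (1%N :: c) i.+1)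
    (nth 0%N (0%N :: t) i) (tnth t i).

Lemma sharp_termE (z : 'I_d.+1 -> C) n t : t \in chains d.+1 n ->
  sharp_term c m z t = ((tnth t m)%:R ^+ 2)^-1 *
    \prod_(i < d.+1) (chain_link t i / ((tnth t i)%:R ^+ 2 - z i ^+ 2)).
Proof.
move=> tn; rewrite /sharp_term; congr (_ * _); apply: eq_bigr => i _.
rewrite /chain_link /link /delta_i !cextE mulrAC; congr (_ * _ / _).
rewrite -(sharp_rmorph (real_complex R)); congr (_%:C).
case: (posnP i) => i0; last first.
  rewrite sharp_sumE // (tnth_nth 0%N); case: (nat_of_ord i) i0 (ltn_ord i) => //= j _ jd.
  have jj : (j <= j.+1 <= d)%N by rewrite leqnSn.
  by case/andP: (chains_nth tn jj).
by rewrite i0.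
Qed.

(** Bounds the product of k_i^2 / |k_i^2 - z_i^2|, because k_i >= 1. *)
Definition term_const (z : 'I_d.+1 -> C) : C := \prod_(i < d.+1) (1 - `|z i| ^+ 2)^-1.

Lemma inv_sub_bound (z : C) k : `|z| < 1 -> (0 < k)%N ->
  `|(k%:R ^+ 2 - z ^+ 2)^-1| <= (1 - `|z| ^+ 2)^-1 * (k%:R ^+ 2)^-1.
Proof.
move=> z1 k0; have k1 : 1 <= k%:R ^+ 2 :> C by rewrite exprn_ege1 // ler1n.
have z2 : 0 < 1 - `|z| ^+ 2 by rewrite subr_gt0 exprn_ilt1.
have key : (1 - `|z| ^+ 2) * k%:R ^+ 2 <= `|k%:R ^+ 2 - z ^+ 2|.
  apply: le_trans (lerB_dist _ _); rewrite !normrX normr_nat mulrBl mul1r.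
  by rewrite lerD2l lerN2 ler_peMr // exprn_ge0.
have pos : 0 < (1 - `|z| ^+ 2) * k%:R ^+ 2.
  by rewrite mulr_gt0 // (lt_le_trans ltr01).
by rewrite normfV -invfM lef_pV2 ?posrE // (lt_le_trans pos key).
Qed.

Lemma chain_link_norm n t (i : 'I_d.+1) : t \in chains d.+1 n ->
  `|chain_link t i| = (tnth t i)%:R ^+ (delta (nth 0%N (1%N :: c) i)
       + delta (nth 0%N (1%N :: c) i.+1)) / (tnth t i)%:R
    * sharp (nth 0%N (0%N :: t) i) (tnth t i)
        (nseq (nth 0%N (1%N :: c) i - 3) 1%N).
Proof.
move=> tn; have id : (i <= i <= d)%N by rewrite leqnn /= -ltnS.
have /andP[ti _] := chains_nth tn id.
rewrite /chain_link linkE (tnth_nth 0%N) // !normrM normrX normrN1 expr1n mul1r.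
by rewrite normfV normrX normr_nat (ger0_norm (sharp_ge0 _ _ _)).
Qed.

Lemma exponent_bound_chains n t : t \in chains d.+1 n ->
  ((tnth t m)%:R ^+ 2)^-1 * \prod_(i < d.+1)
     ((tnth t i)%:R ^+ (delta (nth 0%N (1%N :: c) i)
       + delta (nth 0%N (1%N :: c) i.+1)) / (tnth t i)%:R * ((tnth t i)%:R ^+ 2)^-1)
  <= ((thead t)%:R ^+ 2)^-1 * \prod_(i < d) (nth 0%N t i.+1)%:R^-1 :> C.
Proof.
move=> tn; pose k i := nth 0%N t i; pose e i := delta (nth 0%N (1%N :: c) i).
have kd i j : (i <= j <= d)%N -> (0 < k j <= k i)%N by exact: chains_nth tn.
have k0 i : (i <= d)%N -> (k i)%:R != 0 :> C.
  by move=> id; rewrite pnatr_eq0 -lt0n; case/andP: (kd i i ltac:(by rewrite leqnn)).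
have kpos i : (i <= d)%N -> 0 < (k i)%:R :> C.
  by move=> id; rewrite lt_def k0 // ler0n.
have de1 x : (0 < x)%N -> (delta x <= 1)%N.
  by rewrite /delta; case: x => //= x _; case: ifP.
have t0 : thead t = k 0%N by rewrite /k /thead (tnth_nth 0%N).
have H : (\prod_(i < d.+1) k i ^ (e i + e i.+1)
    <= k m ^ 2 * k 0 * \prod_(i < d) k i.+1 ^ 2)%N.
  apply: exponent_bound => //.
  - by rewrite -ltnS.
  - by move=> i id; apply: kd; rewrite id leqnn.
  - case=> // i id; apply: de1 => /=.
    by have [] := hc (Ordinal id); rewrite (tnth_nth 0%N).
  - by rewrite /e /delta; case: eqP => //; case: eqP.
  - by move=> /hc1 /= c3; rewrite /e /= /delta !gtn_eqF //; exact: leq_trans c3.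
rewrite t0 (tnth_nth 0%N) -/(k m).
rewrite (eq_bigr (fun i : 'I_d.+1 => (k i ^ (e i + e i.+1))%:R * (((k i)%:R ^+ 3)^-1 : C))); last first.
  move=> i _; rewrite (tnth_nth 0%N) -/(k i) -/(e i) -/(e i.+1) natrX -mulrA.
  by rewrite -invfM -exprS.
rewrite big_split /= -natr_prod.
have -> : \prod_(i < d.+1) ((k i)%:R ^+ 3)^-1
    = ((k 0%N)%:R ^+ 3)^-1 * (\prod_(i < d) (k i.+1)%:R^-1) ^+ 3 :> C.
  rewrite big_ord_recl -prodrXl; congr (_ * _).
  by apply: eq_bigr => i _; rewrite exprVn.
have q0 : 0 < \prod_(i < d) (k i.+1)%:R^-1 :> C.
  by apply: prodr_gt0 => i _; rewrite invr_gt0 kpos.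
set q := \prod_(i < d) _ in q0 *.
have {}H : (\prod_(i < d.+1) k i ^ (e i + e i.+1))%:R
    <= (k m)%:R ^+ 2 * (k 0%N)%:R * (q^-1 ^+ 2) :> C.
  move: H; rewrite -(ler_nat C) => /le_trans; apply.
  rewrite 2!natrM natrX natr_prod.
  rewrite le_eqVlt; apply/orP; left; apply/eqP; congr (_ * _).
  rewrite /q -prodfV -prodrXl; apply: eq_bigr => i _.
  by rewrite natrX invrK.
have m0 := kpos m (ltn_ord m); have z0 := kpos 0%N (leq0n d).
apply: le_trans (_ : ((k m)%:R ^+ 2)^-1 * (((k m)%:R ^+ 2 * (k 0%N)%:R * (q^-1 ^+ 2))
   * (((k 0%N)%:R ^+ 3)^-1 * q ^+ 3)) <= _).
  apply: ler_wpM2l; first by rewrite invr_ge0 exprn_ge0 // ltW.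
  apply: ler_wpM2r => //; rewrite mulr_ge0 ?invr_ge0 ?exprn_ge0 // ltW //.
rewrite le_eqVlt; apply/orP; left; apply/eqP; field.
by rewrite !gt_eqF.
Qed.

(** The sharp sum S#_(0, k_0) in front is over the empty string and contributes
    the factor 2. *)
Lemma sharp_term_bound (z : 'I_d.+1 -> C) n t :
  (forall j, `|z j| < 1) -> t \in chains d.+1 n ->
  `|sharp_term c m z t| <= term_const z * (((thead t)%:R ^+ 2)^-1 *
    (2 * \prod_(i < d) majorant c i (nth 0%N t i) (nth 0%N t i.+1))).
Proof.
move=> z1 tn; rewrite (sharp_termE _ tn) normrM normfV normrX normr_nat normr_prod.
pose S i : C := sharp (nth 0%N (0%N :: t) i) (nth 0%N t i)
        (nseq (nth 0%N (1%N :: c) i - 3) 1%N).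
have tpos (i : 'I_d.+1) : (0 < tnth t i)%N by exact: chains_gt0 tn.
apply: le_trans (_ : ((tnth t m)%:R ^+ 2)^-1 * \prod_(i < d.+1)
   (S i * ((1 - `|z i| ^+ 2)^-1 * ((tnth t i)%:R ^+ (delta (nth 0%N (1%N :: c) i)
       + delta (nth 0%N (1%N :: c) i.+1)) / (tnth t i)%:R * ((tnth t i)%:R ^+ 2)^-1))) <= _).
  apply: ler_wpM2l; first by rewrite invr_ge0 exprn_ge0.
  apply: ler_prod => i _; rewrite normr_ge0 /= normrM (chain_link_norm _ tn).
  rewrite (_ : S i * _ = (tnth t i)%:R ^+ (delta (nth 0%N (1%N :: c) i)
       + delta (nth 0%N (1%N :: c) i.+1)) / (tnth t i)%:R * S i * ((1 - `|z i| ^+ 2)^-1 * ((tnth t i)%:R ^+ 2)^-1)); last by ring.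
  rewrite /S (tnth_nth 0%N) -(tnth_nth 0%N).
  apply: ler_wpM2l; last exact: inv_sub_bound.
  by rewrite mulr_ge0 ?sharp_ge0 // divr_ge0 // exprn_ge0.
rewrite big_split /= big_split /= -/(term_const z).
have -> : \prod_(i < d.+1) S i = 2 * \prod_(i < d) sharp (nth 0%N t i) (nth 0%N t i.+1) (nseq (nth 0%N c i - 3) 1%N).
  rewrite big_ord_recl; congr (_ * _).
  rewrite /S /= /Delta eq_sym gtn_eqF ?expr1 //.
  by have := tpos ord0; rewrite (tnth_nth 0%N).
have -> : \prod_(i < d) majorant c i (nth 0%N t i) (nth 0%N t i.+1)
    = \prod_(i < d) (nth 0%N t i.+1)%:R^-1 *
      \prod_(i < d) sharp (nth 0%N t i) (nth 0%N t i.+1)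
        (nseq (nth 0%N c i - 3) 1%N) :> C.
  by rewrite -big_split.
have T0 : 0 <= term_const z.
  by apply: prodr_ge0 => i _; rewrite invr_ge0 subr_ge0 exprn_ile1 // ltW.
set P := \prod_(i < d) sharp _ _ _.
have P0 : 0 <= P by apply: prodr_ge0 => i _; exact: sharp_ge0.
have := exponent_bound_chains tn; set Y := \prod_(i < d.+1) _; set q := \prod_(i < d) _ => H.
rewrite [leLHS](_ : _ = term_const z * (2 * P * (((tnth t m)%:R ^+ 2)^-1 * Y))); last by ring.
rewrite (_ : ((thead t)%:R ^+ 2)^-1 * (2 * (q * P)) = 2 * P * (((thead t)%:R ^+ 2)^-1 * q)); last by ring.
by apply: ler_wpM2l => //; apply: ler_wpM2l => //; rewrite mulr_ge0.
Qed.

Lemma sharp_term_summable (z : 'I_d.+1 -> C) : (forall j, `|z j| < 1) ->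
  exists M : R, forall n, \sum_(t <- chains d.+1 n) Re `|sharp_term c m z t| <= M.
Proof.
move=> z1; have [M HM] := @sum_majorant C c d.
exists (Re (term_const z * M)) => n.
have H : (\sum_(t <- chains d.+1 n) Re `|sharp_term c m z t|)%:C <= term_const z * M.
  rewrite rmorph_sum; apply: le_trans (ler_wpM2l _ (HM n)); last first.
    by apply: prodr_ge0 => i _; rewrite invr_ge0 subr_ge0 exprn_ile1 // ltW.
  rewrite mulr_sumr big_seq [leRHS]big_seq; apply: ler_sum => t tn.
  by have := sharp_term_bound z1 tn; rewrite -(norm_ReE (sharp_term _ _ _ _)).
by move: H; rewrite lecE /= => /andP[].
Qed.

(** * The identity at level n and its limit *)

Lemma sstar_two_string n (a : d.+1.-tuple nat) : (0 < n)%N ->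
  sstar n (two_string c a) = - (\sum_(t <- chains d.+1 n) beta n (thead t) *
    \prod_(i < d.+1) (chain_link t i * ((tnth t i)%:R ^+ (tnth a i).*2.+2)^-1)) :> C.
Proof.
move=> n0; case/tupleP: a => a0 a; set a' := [tuple of a0 :: a].
have -> : two_string c a' = twos_string a0 (zip c a).
  by rewrite /two_string theadE.
have sz : size c = size a by rewrite !size_tuple.
have szl : size (zip c a) = d by rewrite size1_zip ?size_tuple // sz.
have un1 : unzip1 (zip c a) = c by rewrite unzip1_zip // sz.
have un2 : unzip2 (zip c a) = a by rewrite unzip2_zip // sz.
rewrite sstar_dual //; last first.
  rewrite -(all_map fst (fun x => (0 < x)%N && (x != 2%N))) -/(unzip1 _) un1.
  apply/(all_tnthP) => i; have [-> /eqP ->] := hc i; by [].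
rewrite (dual_sum_nest _ _ szl) un1 un2; apply: (congr1 -%R).
apply: eq_bigr => t _; apply: (congr1 ( *%R _)); apply: eq_bigr => i _.
by rewrite (tnth_nth 0%N a').
Qed.

Lemma norm_div_nat_lt1 (z : C) k : `|z| < 1 -> `|(z / k%:R) ^+ 2| < 1.
Proof.
move=> z1; rewrite normrX exprn_ilt1 // normrM normfV normr_nat.
case: k => [|k]; first by rewrite invr0 mulr0.
by rewrite ltr_pdivrMr // (lt_le_trans z1) // mul1r ler1n.
Qed.

Lemma sub_sqr_neq0 (z : C) k : `|z| < 1 -> (0 < k)%N -> k%:R ^+ 2 - z ^+ 2 != 0.
Proof.
move=> z1 k0; apply/negP => /eqP E.
have k0' : k%:R != 0 :> C by rewrite pnatr_eq0 -lt0n.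
have := norm_div_nat_lt1 k z1; have -> : (z / k%:R) ^+ 2 = 1.
  by rewrite expr_div_n -(subr0_eq E) divff // expf_neq0.
by rewrite normr1 ltxx.
Qed.

Definition weighted_sum (z : 'I_d.+1 -> C) (n : nat) : C :=
  \sum_(t <- chains d.+1 n) beta n (thead t) * sharp_term c m z t.

Definition monomial (z : 'I_d.+1 -> C) (a : d.+1.-tuple nat) : C :=
  \prod_(j < d.+1) z j ^+ (2 * tnth a j).

Definition sstar_weight (n : nat) (a : d.+1.-tuple nat) : R :=
  if (1 <= tnth a m)%N then sstar n (two_string c a) else 0.

(** Exchanging the finite sum over chains with the sum over a leaves, for each
    chain, the product of geometric series of [hassum_geometric]. *)
Lemma hassum_sstar (z : 'I_d.+1 -> C) n : (forall j, `|z j| < 1) -> (0 < n)%N ->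
  hassum (fun a => (sstar_weight n a)%:C * monomial z a)
    (- z m ^+ 2 * weighted_sum z n).
Proof.
move=> z1 n0.
pose q (t : d.+1.-tuple nat) i := (z (inord i) / (nth 0%N t i)%:R) ^+ 2.
pose A t := - (beta n (thead t) * \prod_(i < d.+1) (chain_link t i * ((tnth t i)%:R ^+ 2)^-1)) : C.
have qE t (i : 'I_d.+1) : q t i = (z i / (tnth t i)%:R) ^+ 2.
  by rewrite /q inord_val (tnth_nth 0%N).
have H t := hassumZ (A t) (@hassum_geometric R d.+1 (q t) m (fun i _ =>
  norm_div_nat_lt1 _ (z1 _))).
have {H} := @hassum_sum _ _ _ (chains d.+1 n) _ _ H.
set L := \sum_(t <- _) _.
have -> : L = - z m ^+ 2 * weighted_sum z n.
  rewrite /L /weighted_sum mulr_sumr; apply: eq_big_seq => t tn.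
  rewrite (sharp_termE z tn) /A.
  have tpos (i : 'I_d.+1) : (0 < tnth t i)%N by exact: chains_gt0 tn.
  set P := \prod_(i < d.+1) (chain_link t i / ((tnth t i)%:R ^+ 2 - z i ^+ 2)).
  have -> : \prod_(i < d.+1) (chain_link t i * ((tnth t i)%:R ^+ 2)^-1) =
      P * \prod_(i < d.+1) (1 - q t i).
    rewrite /P -big_split /=; apply: eq_bigr => i _; rewrite qE.
    have k0 : (tnth t i)%:R != 0 :> C by rewrite pnatr_eq0 -lt0n.
    have s0 := sub_sqr_neq0 (z1 i) (tpos i).
    by field; rewrite s0 k0.
  have -> : \prod_(i < d.+1) (q t i ^+ (i == m :> nat) / (1 - q t i)) =
      (z m / (tnth t m)%:R) ^+ 2 * (\prod_(i < d.+1) (1 - q t i))^-1.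
    rewrite big_split /= prodfV; congr (_ * _).
    rewrite (bigD1 m) //= eqxx expr1 qE big1 ?mulr1 // => i im.
    by rewrite -val_eqE in im *; rewrite (negPf im) expr0.
  have : \prod_(i < d.+1) (1 - q t i) != 0.
    apply/prodf_neq0 => i _; rewrite subr_eq0; apply: contraTneq (norm_div_nat_lt1 (tnth t i) (z1 i)) => E.
    by rewrite -qE -E normr1 ltxx.
  have k0 : (tnth t m)%:R != 0 :> C by rewrite pnatr_eq0 -lt0n.
  move: (\prod_(i < d.+1) (1 - _)) => X X0.
  by field; rewrite X0 k0.
apply: eq_hassum => a; rewrite /sstar_weight; case: ltnP => am.
  rewrite (sstar_rmorph (real_complex R)) sstar_two_string // mulNr mulr_suml -sumrN.
  apply: eq_bigr => t _; rewrite /A mulNr -!mulrA; congr (- (_ * _)).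
  rewrite -!big_split /=; apply: eq_bigr => i _.
  have -> : (i == m :> nat) && (tnth a i == 0%N) = false.
    by apply/negbTE; rewrite negb_and; case: eqP => //= /val_inj ->; rewrite -lt0n.
  rewrite qE -(addn2 _.*2) -mul2n exprD -exprM expr_div_n [(_ * _ ^+ 2)^-1]invfM.
  by ring.
rewrite mul0r big1 // => t _; rewrite (bigD1 m) //= eqxx /=.
by move: am; rewrite leqn0 => ->; rewrite mul0r mulr0.
Qed.

Lemma weighted_sum_bound (z : 'I_d.+1 -> C) : (forall j, `|z j| < 1) ->
  exists M : R, forall n, Re `|weighted_sum z n| <= M.
Proof.
move=> z1; have [M HM] := sharp_term_summable z1.
exists M => n; apply: le_trans (HM n).
rewrite -lecR norm_ReE; apply: le_trans (ler_norm_sum _ _ _) _.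
rewrite rmorph_sum; apply: ler_sum => t _.
rewrite normrM (ger0_norm (beta_ge0 _ _)) -[leRHS]mul1r -[leRHS]/(1 * (Re `|_|)%:C) norm_ReE.
by apply: ler_wpM2r => //; exact: beta_le1.
Qed.

(** At |z_j| all terms on the left are nonnegative, so each of their partial
    sums is at most the value given by [hassum_sstar]. *)
Lemma sstar_weight_summable (z : 'I_d.+1 -> C) : (forall j, `|z j| < 1) ->
  exists M : R, forall n (I : {fset d.+1.-tuple nat}),
    \sum_(a <- I) sstar_weight n.+1 a * Re `|monomial z a| <= M.
Proof.
move=> z1; have z1' j : `| `|z j| | < 1 by rewrite normr_id.
have [M HM] := weighted_sum_bound z1'.
exists M => n I.
have w0 a : 0 <= sstar_weight n.+1 a * Re `|monomial z a|.
  by rewrite mulr_ge0 ?Re_norm_ge0 // /sstar_weight; case: ifP => // _; exact: sstar_ge0.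
have H : hassum (fun a => (sstar_weight n.+1 a * Re `|monomial z a|)%:C)
    (- `|z m| ^+ 2 * weighted_sum (fun j => `|z j|) n.+1).
  apply: eq_hassum (hassum_sstar z1' (ltn0Sn n)) => a.
  rewrite [RHS]rmorphM [X in _ = _ * X](norm_ReE (monomial z a)) /monomial normr_prod.
  by congr (_ * _); apply: eq_bigr => i _; rewrite normrX.
apply: le_trans (hassum_real_ge I w0 H) _.
apply: le_trans (HM n.+1); apply: le_trans (ler_norm _) _.
apply: le_trans (ler_Re_norm _) _.
rewrite -lecR !norm_ReE normrM normrN normrX normr_id -[leRHS]mul1r.
by apply: ler_wpM2r => //; rewrite exprn_ile1 // ltW.
Qed.

(** Read off from [sstar_weight_summable] at z_j = 1/2, keeping one term. *)
Lemma sstar_two_string_bounded a : (1 <= tnth a m)%N ->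
  exists M : R, forall n, sstar n (two_string c a) <= M.
Proof.
move=> am; pose z (j : 'I_d.+1) : C := 2^-1.
have z1 j : `|z j| < 1.
  by rewrite ger0_norm ?invr_ge0 // invf_lt1 // ltr1n.
have [M HM] := sstar_weight_summable z1.
have mon0 : 0 < Re `|monomial z a|.
  rewrite -ltcR norm_ReE normr_gt0; apply/prodf_neq0 => i _.
  by rewrite expf_neq0 // invr_neq0 // pnatr_eq0.
exists (M / Re `|monomial z a|) => n.
apply: le_trans (sstar_mono _ (leqnSn n)) _.
rewrite ler_pdivlMr //; have := HM n [fset a]%fset.
by rewrite big_seq_fset1 /sstar_weight am.
Qed.

(** The weights [beta n k_0] increase to 1 and are bounded by it. *)
Lemma hassum_sharp_term (z : 'I_d.+1 -> C) : (forall j, `|z j| < 1) ->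
  exists2 L, hassum (patch (fun=> 0) (weakly_decreasing d.+1) (sharp_term c m z)) L
    & forall e : R, 0 < e -> \forall n \near \oo, Re `|weighted_sum z n - L| < e.
Proof.
move=> z1; pose b (t : d.+1.-tuple nat) := sorted geq (rcons t 1%N).
rewrite (@patch_indicator _ _ _ b) //.
have [M HM] := sharp_term_summable z1.
pose s n t : R := if b t then beta n (thead t) else 0.
apply: (@hassum_monotone_weights _ _ s _ _ _ M).
- move=> n t; rewrite /s; case: (b t); rewrite ?lexx //.
  by rewrite beta_ge0 beta_le1.
- move=> t; rewrite /s; case: (b t); [exact: beta_cvg | exact: cvg_cst].
- move=> n I; pose r := [seq t <- I | b t].
  have [N HN] : exists N, forall t, t \in r -> t \in chains d.+1 N.
    apply: chains_exhaust => t; rewrite mem_filter => /andP[bt _].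
    by rewrite /weakly_decreasing.
  apply: le_trans (HM N); rewrite (bigID b) /= [X in _ + X]big1 ?addr0; last first.
    by move=> t /negbTE bt; rewrite /s bt mul0r.
  rewrite -big_filter -/r -(sum_fset_seq _ (chains_uniq _ _)).
  have ur : uniq r by exact/filter_uniq/fset_uniq.
  apply: le_trans (_ : \sum_(t <- r) Re `|sharp_term c m z t| <= _).
    apply: ler_sum => t _; rewrite -[leRHS]mul1r ler_wpM2r ?Re_norm_ge0 //.
    by rewrite /s; case: (b t) => //; exact: beta_le1.
  rewrite -(sum_fset_seq _ ur); apply: ler_sum_fsubset.
    by move=> t; exact: Re_norm_ge0.
  by apply/fsubsetP => t; rewrite !inE => /HN.
- move=> n; have := @hassum_finite _ _ [fset t in chains d.+1 n]%fset
     (fun t => (s n t)%:C * sharp_term c m z t).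
  rewrite sum_fset_seq ?chains_uniq //.
  rewrite (_ : \sum_(t <- _) _ = weighted_sum z n); last first.
    apply: eq_big_seq => t; rewrite mem_chainsS -/(b t) => /andP[bt _].
    by rewrite /s bt (beta_rmorph (real_complex R)).
  apply=> t; rewrite inE mem_chainsS -/(b t) /s; case: (b t); last by rewrite mul0r.
  by rewrite -ltnNge => /beta_gt ->; rewrite mul0r.
Qed.

(** The truncated star sums increase to the zeta star values.  The levels are
    shifted by one because [hassum_sstar] starts at n = 1. *)
Lemma hassum_zeta_term (z : 'I_d.+1 -> C) : (forall j, `|z j| < 1) ->
  exists2 L, hassum (patch (fun=> 0) [set a : d.+1.-tuple nat | (1 <= tnth a m)%N]
                       (zeta_term c z)) L
    & forall e : R, 0 < e ->
      \forall n \near \oo, Re `|- z m ^+ 2 * weighted_sum z n.+1 - L| < e.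
Proof.
move=> z1; rewrite (@patch_indicator _ _ _ (fun a => 1 <= tnth a m)%N) //.
have [M HM] := sstar_weight_summable z1.
pose S (a : d.+1.-tuple nat) : R :=
  if (1 <= tnth a m)%N then zeta_star R (two_string c a) else 0.
have := @hassum_monotone_weights _ _ (fun n => sstar_weight n.+1) S (monomial z)
  (fun n => - z m ^+ 2 * weighted_sum z n.+1) M.
case.
- move=> n a; rewrite /sstar_weight /S; case: ifP => am; last by rewrite lexx.
  have [B HB] := sstar_two_string_bounded am.
  by rewrite sstar_ge0 (sstar_le_zeta HB).
- move=> a; rewrite /sstar_weight /S; case: ifP => am; last exact: cvg_cst.
  have [B HB] := sstar_two_string_bounded am.
  by rewrite (cvg_shiftS (fun n => sstar n (two_string c a) : R)); exact: (sstar_cvg HB).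
- exact: HM.
- by move=> n; exact: hassum_sstar.
move=> L HL cvL; exists L => //; apply: eq_hassum HL => a.
by rewrite /S /zeta_term; case: ifP => _; rewrite ?mul1r ?mul0r.
Qed.

End SharpTerm.

Theorem theorem1p5 (R : realType) (d : nat) (m : 'I_d.+1)
  (c : d.-tuple nat) (z : 'I_d.+1 -> R[i])
  (hc : forall i : 'I_d, (0 < tnth c i)%N /\ tnth c i <> 2%N)
  (hc1 : (0 < m)%N -> (3 <= nth 0%N c 0)%N)
  (hz : forall j : 'I_d.+1, `|z j| < 1) :
  [/\ csummable [set a : d.+1.-tuple nat | (1 <= tnth a m)%N] (zeta_term c z),
      csummable (weakly_decreasing d.+1) (sharp_term c m z)
    & csum [set a : d.+1.-tuple nat | (1 <= tnth a m)%N] (zeta_term c z)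
      = - z m ^+ 2 * csum (weakly_decreasing d.+1) (sharp_term c m z)].
Proof.
have [L HL cvL] := hassum_sharp_term hc hc1 hz.
have [L' HL' cvL'] := hassum_zeta_term hc hc1 hz.
have [sR ->] := csum_hassum HL; have [sL ->] := csum_hassum HL'; split => //.
apply/eqP; rewrite -subr_eq0 -normr_eq0; apply/negPn/negP => LL.
have e0 : 0 < Re `|L' - - z m ^+ 2 * L|.
  by rewrite -ltcR norm_ReE lt_def LL normr_ge0.
have e2 : 0 < Re `|L' - - z m ^+ 2 * L| / 2 by rewrite divr_gt0.
have [N1 _ H1] := cvL _ e2; have [N2 _ H2] := cvL' _ e2.
have := H1 (maxn N1 N2).+1; have := H2 (maxn N1 N2).
rewrite /= leq_maxr (leq_trans (leq_maxl _ _) (leqnSn _)).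
move=> /(_ isT) K2 /(_ isT) K1; set w := weighted_sum _ _ _ _ in K1 K2.
suff : Re `|L' - - z m ^+ 2 * L| < Re `|L' - - z m ^+ 2 * L| by rewrite ltxx.
rewrite -ltc_norm; apply: le_lt_trans (ler_distD (- z m ^+ 2 * w) _ _) _.
rewrite [Re _]splitr rmorphD; apply: ltrD; rewrite ltc_norm; first by rewrite distrC.
apply: le_lt_trans K1; rewrite -mulrBr -lecR !norm_ReE.
rewrite normrM normrN normrX -[leRHS]mul1r; apply: ler_wpM2r => //.
by rewrite exprn_ile1 // ltW.
Qed.
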